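(* Let $\mu$ be a positive Borel measure on $(0,\infty)$ satisfying $\mu((0,1))=0$, let $1\leq p,q\leq\infty$, and let $\phi$ be a weight. (i) If $\mathcal{H}_\mu$ is uniformly mean ergodic on $F_\phi^{p,q}$, then $$\int_{[1,\infty)}\frac{1}{t}\,d\mu(t)\leq 1.$$ (ii) If $$\int_{[1,\infty)}\frac{1}{t}\,d\mu(t)<1,$$ then $\mathcal{H}_\mu$ is uniformly mean ergodic on $F_\phi^{p,q}$, and $\lim_{n\to\infty}(\mathcal{H}_\mu)_{[n]}=0$ in operator norm.
   Context: $H(\mathbb{C})$ denotes the space of entire functions. Let $\phi:[0,\infty)\to\mathbb{R}^+$ be continuously differentiable, extended radially to $\mathbb{C}$ by $\phi(z)=\phi(|z|)$. It is called a weight if $\int_0^\infty e^{-q\phi(r)}r\,dr<\infty$ for the exponent $q$ under consideration, $0<q<\infty$ (when the space considered has $q=\infty$, the integral condition is understood for some finite exponent). For $f\in H(\mathbb{C})$ and $0\le r<\infty$ let $M_p(f,r)=\left(\frac{1}{2\pi}\int_0^{2\pi}|f(re^{i\theta})|^p\,d\theta\right)^{1/p}$ for $0<p<\infty$ and $M_\infty(f,r)=\sup_{|z|=r}|f(z)|$. For $0<p\le\infty$, the weighted mixed norm Fock space $F_\phi^{p,q}$ consists of all $f\in H(\mathbb{C})$ with $\|f\|_{p,q,\phi}<\infty$, where $\|f\|_{p,q,\phi}^q=\int_0^\infty M_p^q(f,r)e^{-q\phi(r)}r\,dr$ if $0<q<\infty$, and $\|f\|_{p,\infty,\phi}=\sup_{r\in[0,\infty)}M_p(f,r)e^{-\phi(r)}$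 if $q=\infty$. For $1\le p,q\le\infty$ it is a Banach space. For a positive Borel measure $\mu$ on $(0,\infty)$, the Hausdorff operator is defined formally by $\mathcal{H}_\mu f(z)=\int_{(0,\infty)}\frac{1}{t}f\left(\frac{z}{t}\right)d\mu(t)$, $z\in\mathbb{C}$, for $f\in H(\mathbb{C})$. It is bounded on $F_\phi^{p,q}$ if this formula defines a bounded linear operator from $F_\phi^{p,q}$ to itself. For a bounded linear operator $T$ on a Banach space $X$ the Cesàro means are $T_{[n]}=\frac{1}{n}\sum_{k=1}^nT^k$, $n\in\mathbb{N}$. A bounded linear operator $T$ on $X$ is uniformly mean ergodic if there is a bounded linear operator $P$ on $X$ with $T_{[n]}\to P$ in operator norm as $n\to\infty$. *)

(* Defs.v *)
From HB Require Import structures.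
From mathcomp Require Export all_boot all_order all_algebra.
From mathcomp Require Export all_classical all_reals all_analysis.
From mathcomp Require Export complex.

Import Order.TTheory GRing.Theory Num.Theory.
Import numFieldNormedType.Exports.

Set Implicit Arguments.
Unset Strict Implicit.
Unset Printing Implicit Defensive.

Local Open Scope classical_set_scope.
Local Open Scope complex_scope.
Local Open Scope ring_scope.

(** * Uniform mean ergodicity
    A normed space is given as a subspace [X] of a vector space [V] together
    with an extended-real-valued function [N] on [V] that is a finite norm
    on [X]. Operators on [X] are functions on [V] considered on [X] only. *)
Section mean_ergodic.
Context (R : realType) (K : numFieldType) (V : lmodType K).
Variables (X : set V) (N : V -> \bar R).

Definition bounded_operator (T : V -> V) : Prop :=
  [/\ forall f, X f -> X (T f),
      forall (a : K) f g, X f -> X g -> T (a *: f + g) = a *: T f + T g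
    & exists C : R, forall f, X f -> (N (T f) <= C%:E * N f)%E].

Definition opnorm (T : V -> V) : \bar R :=
  ereal_sup [set N (T f) | f in [set f | X f /\ (N f <= 1)%E]].

Definition cesaro_mean (T : V -> V) (n : nat) : V -> V :=
  fun f => n%:R^-1 *: \sum_(1 <= k < n.+1) iter k T f.

Definition uniformly_mean_ergodic (T : V -> V) : Prop :=
  bounded_operator T /\
  exists P : V -> V, bounded_operator P /\
    (fun n => opnorm (fun f => cesaro_mean T n f - P f)) @ \oo --> 0%E.

End mean_ergodic.

Section fock.
Context (R : realType).
Local Notation C := R[i].
Local Notation leb := (@lebesgue_measure R).
Local Notation normc := ComplexField.Normc.normc.

(* Complex differentiability: [C^o] is a normed space over the field [C]
   itself, so the increments in [derivable] are complex. *)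
Definition entire : set (C^o -> C^o) :=
  [set f | forall z : C^o, derivable f z 1].

(* [phi] is only constrained on [0, +oo[; the derivative at 0 is one-sided. *)
Definition continuously_differentiable (phi : R -> R) : Prop :=
  exists dphi : R -> R,
    {within `[0, +oo[, continuous dphi} /\
    forall r, 0 <= r ->
      (phi s - phi r) / (s - r) @[s --> within [set s | 0 <= s] r^'] --> dphi r.

Definition weight_integral (q : R) (phi : R -> R) : \bar R :=
  (\int[leb]_(r in `[0%R, +oo[) (expR (- (q * phi r)) * r)%:E)%E.

Definition is_weight (q : \bar R) (phi : R -> R) : Prop :=
  [/\ continuously_differentiable phi,
      forall r, 0 <= r -> 0 <= phi r
    & match q with
      | q'%:E => (weight_integral q' phi < +oo)%E
      | +oo%E => exists2 q' : R, 0 < q' & (weight_integral q' phi < +oo)%E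
      | -oo%E => False
      end].

(* The exponents are positive in all uses; [-oo] gets a dummy value. *)
Definition integral_mean (p : \bar R) (f : C^o -> C^o) (r : R) : \bar R :=
  match p with
  | p'%:E => (((2 * pi)^-1)%:E *
      \int[leb]_(x in `[0%R, (2 * pi)%R])
        (normc (f (r * cos x +i* (r * sin x))) `^ p')%:E) `^ p'^-1
  | +oo => ereal_sup [set (normc (f z))%:E | z in [set z | normc z = r]]
  | -oo => 0
  end%E.

Definition fock_norm (p q : \bar R) (phi : R -> R) (f : C^o -> C^o) : \bar R :=
  match q with
  | q'%:E => (\int[leb]_(r in `[0%R, +oo[)
      (integral_mean p f r `^ q' * (expR (- (q' * phi r)) * r)%:E)) `^ q'^-1
  | +oo => ereal_sup [set integral_mean p f r * (expR (- phi r))%:E |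
                       r in `[0%R, +oo[]
  | -oo => 0
  end%E.

Definition fock (p q : \bar R) (phi : R -> R) : set (C^o -> C^o) :=
  [set f | entire f /\ (fock_norm p q phi f < +oo)%E].

Definition cintegrable (mu : {measure set (measurableTypeR R) -> \bar R})
    (D : set R) (g : R -> C) : Prop :=
  mu.-integrable D (fun t => (complex.Re (g t))%:E) /\
  mu.-integrable D (fun t => (complex.Im (g t))%:E).

Definition cintegral (mu : {measure set (measurableTypeR R) -> \bar R})
    (D : set R) (g : R -> C) : C :=
  (\int[mu]_(t in D) complex.Re (g t)) +i* (\int[mu]_(t in D) complex.Im (g t)).

Definition hausdorff_integrand (f : C^o -> C^o) (z : C) (t : R) : C :=
  (t%:C)^-1 * f (z / t%:C).

Definition hausdorff (mu : {measure set (measurableTypeR R) -> \bar R})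
    (f : C^o -> C^o) : C^o -> C^o :=
  fun z => cintegral mu `]0, +oo[ (hausdorff_integrand f z).

(* [cintegral] is total, so convergence of the defining integral on the whole
   space has to be required separately. *)
Definition hausdorff_defined (mu : {measure set (measurableTypeR R) -> \bar R})
    (p q : \bar R) (phi : R -> R) : Prop :=
  forall f, fock p q phi f ->
    forall z : C, cintegrable mu `]0, +oo[ (hausdorff_integrand f z).

Definition hausdorff_uniformly_mean_ergodic
    (mu : {measure set (measurableTypeR R) -> \bar R})
    (p q : \bar R) (phi : R -> R) : Prop :=
  hausdorff_defined mu p q phi /\
  uniformly_mean_ergodic (fock p q phi) (fock_norm p q phi) (hausdorff mu).

End fock.

(* Main.v *)
Require Import Defs.
From mathcomp Require Import ring lra measurable_realfun.
Import Order.TTheory GRing.Theory Num.Theory.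
Import numFieldNormedType.Exports.

Set Implicit Arguments.
Unset Strict Implicit.
Unset Printing Implicit Defensive.

Local Open Scope classical_set_scope.
Local Open Scope complex_scope.
Local Open Scope ring_scope.

(** Let [c] be the integral of [1/t] over [[1, +oo[]. Everything rests on the
    estimate [M_p(H f, r) <= c M_p(f, r)], valid for every entire [f], every
    [r >= 0] and every [p >= 1] ([integral_mean_hausdorff_on]). It is pointwise
    in [r], so the outer norm only has to be monotone and homogeneous, and
    [||H f|| <= c ||f||] follows. If [c < 1], then [||H^k|| <= c^k] and the n-th
    Cesaro mean has norm at most [(c + ... + c^n)/n], which tends to 0.

    Conversely, [H] multiplies constants by [c], and constants belong to the
    space because [phi] is a nonnegative weight. If [c > 1], the n-th Cesaro mean
    of a small constant [e] is the constant [a_n e] with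
    [a_n = (c + ... + c^n)/n] unbounded. Convergence to an operator [P] would
    eventually keep it at distance at most 1 from the single function [P e]. But [P e] is
    bounded on the unit disc, and the norm of a function controls from above any
    uniform lower bound for its integral means on [0 <= r <= 1]
    ([fock_norm_lower]): contradiction.

    The estimate is Minkowski's inequality combined with the fact that
    [M_p(f, r)] increases with [r], since [H f] averages the dilates [f(z/t)]
    with [t >= 1]. To avoid a Minkowski inequality for general measures, [H f]
    is approximated, uniformly on discs, by finite sums [sum_j m_j f(s_j z)] with
    [0 <= s_j <= 1], [m_j >= 0] and [sum_j m_j = c] ([hausdorff_on_approx]). Two
    facts on entire functions are thus needed: the monotonicity of the integral
    means, and that a locally uniform limit of entire functions is entire.

    Both are reached from mere complex differentiability, without contour
    integrals. Goursat's bisection argument, run on closed forms in the plane,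
    gives every entire function a primitive ([primitive]). Let [G] be a second
    primitive of [f]. As the second derivatives of [G] in the directions [h] and
    [i h] cancel, the average of [G] over [z + h], [z - h], [z + i h], [z - i h]
    is [G z + o(|h|^2)], uniformly on discs; second difference quotients of [G]
    inherit this property and approximate [f]. For a function [g] with this
    property and a seminorm [S] dominated by the supremum over a circle,
    [z |-> S(w |-> g(z w)) + e |z|^2] has no maximum inside the unit disc. This
    is a maximum principle ([entire_maximum]) with two uses. With [S] the
    integral mean, which is invariant under rotations, it says that the means
    increase with the radius. With [S] the modulus at a point it is the maximum
    modulus principle, which applied to [k^2 ((f(z + k) - f(z))/k)^n] for all [n]
    bounds difference quotients by the supremum of [|f|], so that uniform
    approximation also controls derivatives ([entire_of_approx]). *)

(** * Antiderivatives on the real line *)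

Section real_line.
Context (R : realType).
Implicit Types (k K f : R -> R).

(** Turns the derivative into an inequality that can be estimated directly and that
    has the same shape for real and complex derivatives (see [cderiv]). *)
Lemma is_derive_eps f (x d : R) :
  is_derive x 1 f d <->
  forall e : R, 0 < e -> exists2 c : R, 0 < c &
    forall h : R, `|h| < c -> `|f (x + h) - f x - d * h| <= e * `|h|.
Proof.
split=> [fd e e0|H].
  have [g [fg cg gx]] := (is_derive1_caratheodory f x d).1 fd.
  have /cvgrPdist_le/(_ _ e0) := cg.
  move=> /nbhs_ballP[c /= c0 Hc].
  exists c => // h hc.
  have := Hc (x + h); rewrite /ball/= opprD addNKr normrN => /(_ hc).
  rewrite gx => Hg.
  have -> : f (x + h) - f x - d * h = - (d - g (x + h)) * h.
    by rewrite fg; ring.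
  by rewrite normrM normrN ler_wpM2r.
suff : h^-1 *: (f (h *: 1 + x) - f x) @[h --> 0^'] --> d.
  by move=> fd; split; [apply: cvgP fd|exact/cvg_lim].
apply/cvgrPdist_le => e e0; have [c c0 Hc] := H _ e0.
apply/nbhs_ballP; exists c => //= h.
rewrite /ball/= sub0r normrN => hc h0.
have := Hc _ hc.
rewrite -[_ *: _ in X in _ -> X]/(h^-1 * _) -[_%:A]/(h * 1) mulr1 [h + x]addrC.
have -> : f (x + h) - f x - d * h = h * (h^-1 * (f (x + h) - f x) - d).
  by rewrite mulrBr mulVKf//; ring.
by rewrite normrM mulrC ler_pM2r ?normr_gt0// distrC.
Qed.

Lemma near_eq_is_derive f g (x d c : R) : 0 < c ->
  (forall h, `|h| < c -> f (x + h) = g (x + h)) ->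
  is_derive x 1 f d -> is_derive x 1 g d.
Proof.
move=> c0 fg /is_derive_eps H; apply/is_derive_eps => e /H[a a0 Ha].
exists (Num.min a c); first by rewrite lt_min a0.
move=> h; rewrite lt_min => /andP[ha hc]; rewrite -fg//.
by have := fg 0; rewrite normr0 addr0 => <-//; apply: Ha.
Qed.

Lemma is_derive_continuous f (d : R -> R) :
  (forall x : R, is_derive x 1 f (d x)) -> continuous f.
Proof. by move=> fd x; apply: differentiable_continuous; apply/derivable1_diffP; case: (fd x). Qed.

Lemma is_derive_addc f (x d c : R) : is_derive x 1 f d ->
  is_derive x 1 (fun y => f y + c) d.
Proof. by move=> fd; rewrite -[d]addr0; apply: is_deriveD. Qed.

Lemma MVT_bound K k (a b c : R) : (forall x : R, is_derive x 1 K (k x)) ->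
  (forall x : R, Num.min a b <= x <= Num.max a b -> `|k x| <= c) ->
  `|K b - K a| <= c * `|b - a|.
Proof.
move=> Kk; wlog ab : a b / a <= b => [H|].
  have [ab|/ltW ab] := leP a b => H'; last first.
    by rewrite distrC (distrC b); apply: H => // x; rewrite (min_idPl ab) (max_idPr ab); exact: H'.
  by apply: H => // x; rewrite (min_idPl ab) (max_idPr ab); exact: H'.
rewrite (min_idPl ab) (max_idPr ab) => kc.
have [x xab ->] := MVT_segment ab (fun x _ => Kk x)
  (continuous_subspaceT (is_derive_continuous Kk)).
by rewrite normrM ler_wpM2r// kc// -in_itv.
Qed.

Let antiderivative_right k : continuous k ->
  exists K, forall x : R, -1 < x -> is_derive x 1 K (k x).
Proof.
move=> ck; exists (fun x => \int[lebesgue_measure]_(t in `[-1, x]) k t) => x x1.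
have [] := @continuous_FTC1_closed R k (-1) x (x + 1) _ _ x1 (ck x).
- by rewrite ltrDl.
- apply: continuous_compact_integrable; first exact: segment_compact.
  exact: continuous_subspaceT.
- by rewrite derive1E; exact: DeriveDef.
Qed.

(** The fundamental theorem of calculus starts from a base point and gives a
    derivative only to its right, so the primitive on the line is glued from one
    for [k] and a reflected one, which differ by a constant on the open interval from -1 to 1. *)
Lemma antiderivative k : continuous k ->
  exists K, forall x : R, is_derive x 1 K (k x).
Proof.
move=> ck.
have [A dA] := antiderivative_right ck.
have [B dB] := @antiderivative_right (k \o -%R)
  (fun x => continuous_comp (@oppr_continuous R R x) (ck (- x))).
have dB' (x : R) : x < 1 -> is_derive x 1 (fun y => - B (- y)) (k x).
  move=> x1; have xN1 : -1 < - x by rewrite ltrN2.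
  have /= dBx := dB _ xN1; rewrite opprK in dBx.
  have dN : is_derive x 1 (-%R : R -> R) (-1) by apply: is_deriveN.
  have := is_derive1_comp dBx dN => /(@is_deriveN _ _ _ _ _ _ _).
  by move=> /is_derive_eq; apply; rewrite mulrN1 opprK.
have AB (x : R) : -1 < x < 1 -> A x + B (- x) = A 0 + B 0.
  move=> x11; have dAB (y : R) : y \in `[Num.min 0 x, Num.max 0 x]%R ->
      is_derive y 1 (A \- (fun y => - B (- y))) 0.
    rewrite in_itv/= => /andP[y1 y2].
    have {}y1 : -1 < y by apply: lt_le_trans y1; rewrite lt_min; lra.
    have {}y2 : y < 1 by apply: le_lt_trans y2 _; rewrite gt_max; lra.
    by have := is_deriveB (dA _ y1) (dB' _ y2); rewrite subrr.
  have m : Num.min 0 x <= Num.max 0 x by case: (leP 0 x) => // /ltW.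
  have cAB : {within `[Num.min 0 x, Num.max 0 x],
      continuous (A \- (fun y => - B (- y)))}.
    by apply: derivable_within_continuous => y /dAB[].
  have [c _] := MVT_segment m (fun y yi => dAB y (subset_itv_oo_cc yi)) cAB.
  rewrite mul0r /= !opprK => /eqP; rewrite subr_eq0 => /eqP.
  by case: (leP 0 x) => _; rewrite oppr0.
exists (fun x => if 0 <= x then A x - A 0 else B 0 - B (- x)) => x.
have [x0|x0] := ltP x (1/2).
  have : is_derive x 1 (fun y => B 0 + - B (- y)) (k x).
    rewrite -[k x]add0r; apply: is_deriveD; apply: dB'; lra.
  apply: (@near_eq_is_derive _ _ _ _ (1/2)); first lra.
  move=> h h2; case: ifPn => // xh.
  have /AB : -1 < x + h < 1 by move: h2; rewrite ltr_norml; lra.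
  by move=> E; apply/eqP; rewrite subr_eq addrAC eq_sym subr_eq E addrC.
have : is_derive x 1 (fun y => A y + - A 0) (k x).
  by rewrite -[k x]addr0; apply: is_deriveD; apply: dA; lra.
apply: (@near_eq_is_derive _ _ _ _ (1/2)); first lra.
move=> h h2; case: ifPn => // xh.
by move: h2 xh; rewrite ltr_norml; lra.
Qed.

End real_line.

(** * Bisection of rectangles *)

Section rectangle_induction.
Context (R : realType).

Lemma ltr_exp2 (x : R) : exists n : nat, x < 2 ^+ n.
Proof.
exists (Num.bound `|x|); apply: le_lt_trans (ler_norm x) _.
apply: lt_trans (archi_boundP (normr_ge0 x)) _.
by rewrite -natrX ltr_nat ltn_expl.
Qed.

(** Compactness of rectangles as an induction principle: a property that is local
    and is inherited from the four quarters holds for every rectangle. Otherwise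
    repeated quartering yields nested bad rectangles, which shrink to a point where
    locality is violated. It serves both Goursat's theorem and compactness of
    discs. Degenerate sides are included so that every quarter is again of the
    same kind. *)
Lemma rectangle_induction (P : R -> R -> R -> R -> Prop) :
  (forall x y w h : R, 0 <= w -> 0 <= h ->
    P x y (w / 2) (h / 2) -> P (x + w / 2) y (w / 2) (h / 2) ->
    P x (y + h / 2) (w / 2) (h / 2) ->
    P (x + w / 2) (y + h / 2) (w / 2) (h / 2) -> P x y w h) ->
  (forall x0 y0 : R, exists2 d : R, 0 < d & forall x y w h : R,
    x <= x0 <= x + w -> y <= y0 <= y + h -> w < d -> h < d -> P x y w h) ->
  forall x y w h : R, 0 <= w -> 0 <= h -> P x y w h.
Proof.
move=> Psplit Ploc x y w h w0 h0; apply: contrapT => nP.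
pose bad n (p : R * R) := ~ P p.1 p.2 (w / 2 ^+ n) (h / 2 ^+ n).
have step n p : exists p' : R * R, bad n p ->
    [/\ bad n.+1 p', p.1 <= p'.1 <= p.1 + w / 2 ^+ n.+1
      & p.2 <= p'.2 <= p.2 + h / 2 ^+ n.+1].
  apply: contrapT => /forallNP H.
  have badp : bad n p by apply: contrapT => H'; apply: (H p) => /H'.
  have pos (u : R) : 0 <= u -> 0 <= u / 2 ^+ n.+1 by move=> ?; rewrite divr_ge0// exprn_ge0.
  have good (a b : R) : (a == 0) || (a == w / 2 ^+ n.+1) ->
      (b == 0) || (b == h / 2 ^+ n.+1) ->
      P (p.1 + a) (p.2 + b) (w / 2 ^+ n.+1) (h / 2 ^+ n.+1).
    move=> Ha Hb; apply: contrapT => nP'.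
    apply: (H (p.1 + a, p.2 + b)) => _; split=> //=.
      by case/orP: Ha => /eqP->; have := pos _ w0; lra.
    by case/orP: Hb => /eqP->; have := pos _ h0; lra.
  have E (u : R) : u / 2 ^+ n / 2 = u / 2 ^+ n.+1 by rewrite exprSr invfM mulrA.
  apply: badp; apply: Psplit; rewrite ?E ?divr_ge0 ?exprn_ge0//.
  - by have := good 0 0; rewrite !addr0; apply; rewrite eqxx.
  - by have := good (w / 2 ^+ n.+1) 0; rewrite !addr0; apply; rewrite eqxx ?orbT.
  - by have := good 0 (h / 2 ^+ n.+1); rewrite !addr0; apply; rewrite eqxx ?orbT.
  - by apply: good; rewrite eqxx ?orbT.
pose s := fix s n := if n is m.+1 then sval (cid (step m (s m))) else (x, y).
have bads n : bad n (s n).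
  elim: n => [|n IH]; first by rewrite /bad/= !divr1.
  by rewrite /=; case: cid => /= p /(_ IH) [].
have inc n : (s n).1 <= (s n.+1).1 <= (s n).1 + w / 2 ^+ n.+1
    /\ (s n).2 <= (s n.+1).2 <= (s n).2 + h / 2 ^+ n.+1.
  by rewrite /=; case: cid => /= p /(_ (bads n)) [].
have halve (u : R) n : u / 2 ^+ n = u / 2 ^+ n.+1 + u / 2 ^+ n.+1.
  by rewrite exprS invfM; lra.
(* each coordinate sequence squeezes to a common point *)
have lim (u : nat -> R) (v : R) : (forall n, u n <= u n.+1 <= u n + v / 2 ^+ n.+1) ->
    exists l, forall n, u n <= l <= u n + v / 2 ^+ n.
  move=> Hu.
  have up n m : (n <= m)%N -> u n <= u m.
    by move: n m; apply/nondecreasing_seqP => i; case/andP: (Hu i).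
  have dn n m : (n <= m)%N -> u m + v / 2 ^+ m <= u n + v / 2 ^+ n.
    move: n m; apply/nonincreasing_seqP => i.
    by have := halve v i; case/andP: (Hu i); lra.
  have v0 n : 0 <= v / 2 ^+ n.
    by have := Hu n; rewrite (halve v n) => /andP[a b]; have := le_trans a b; lra.
  have nm n m : u n <= u m + v / 2 ^+ m.
    have [/up|/ltnW/dn] := leqP n m; first by have := v0 m; lra.
    by have := v0 n; lra.
  exists (sup (range u)) => n; apply/andP; split.
    apply: ub_le_sup; last by exists n.
    by exists (u 0%N + v / 2 ^+ 0) => _ [m _ <-].
  by apply: ge_sup; [exists (u 0%N); exists 0%N|move=> _ [m _ <-]].
have [x0 Hx] := lim (fun n => (s n).1) w (fun n => (inc n).1).
have [y0 Hy] := lim (fun n => (s n).2) h (fun n => (inc n).2).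
have [d d0 Hd] := Ploc x0 y0.
have [n Hn] := ltr_exp2 ((w + h) / d).
have n0 : 0 < 2 ^+ n :> R by rewrite exprn_gt0.
have whd : (w + h) / 2 ^+ n < d.
  by rewrite ltr_pdivrMr// mulrC -ltr_pdivrMr.
apply: (bads n); apply: Hd => //; apply: le_lt_trans whd.
  by rewrite ler_pM2r ?invr_gt0// lerDl.
by rewrite ler_pM2r ?invr_gt0// lerDr.
Qed.

End rectangle_induction.

(** * Potentials of closed forms in the plane *)

Section closed_forms.
Context (R : realType).

(** [P] and [Q] are differentiable at the point and [P_y = Q_x] there: the same
    coefficient [m] occurs in both linearizations. As in Goursat's theorem, the
    condition is pointwise. *)
Definition closed_at (P Q : R -> R -> R) (x0 y0 : R) : Prop :=
  exists p m q : R, forall e : R, 0 < e -> exists2 d : R, 0 < d &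
    forall x y : R, `|x - x0| < d -> `|y - y0| < d ->
    `|P x y - (P x0 y0 + p * (x - x0) + m * (y - y0))| <= e * (`|x - x0| + `|y - y0|) /\
    `|Q x y - (Q x0 y0 + m * (x - x0) + q * (y - y0))| <= e * (`|x - x0| + `|y - y0|).

Section goursat.
Variables (P Q PX QY : R -> R -> R).
Hypothesis dPX : forall x y : R, is_derive x 1 (PX y) (P x y).
Hypothesis dQY : forall x y : R, is_derive y 1 (QY x) (Q x y).
Hypothesis PQ_closed : forall x y : R, closed_at P Q x y.

(** The integral of [P dx + Q dy] along the boundary of a rectangle, written with
    primitives [PX], [QY] of [P], [Q] along the sides, so that no integral has to
    be manipulated. *)
Definition circulation (x y w h : R) : R :=
  (PX y (x + w) - PX y x) + (QY (x + w) (y + h) - QY (x + w) y)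
  - (PX (y + h) (x + w) - PX (y + h) x) - (QY x (y + h) - QY x y).

(** The affine part of [P dx + Q dy] at the point is exact, with the explicit
    potential [W] of the proof, hence only the error terms contribute: a quantity
    at most [e (w + h)] integrated along sides of lengths [w] and [h]. *)
Lemma circulation_local (x0 y0 e : R) : 0 < e ->
  exists2 d : R, 0 < d & forall x y w h : R,
    x <= x0 <= x + w -> y <= y0 <= y + h -> w < d -> h < d ->
    `|circulation x y w h| <= 2 * e * (w + h) ^+ 2.
Proof.
move=> e0; have [p [m [q H]]] := PQ_closed x0 y0.
have [d d0 {}H] := H _ e0; exists d => // x y w h.
move=> xx yy wd hd.
pose W x y := P x0 y0 * x + Q x0 y0 * y + p * ((x - x0) ^+ 2 / 2)
  + q * ((y - y0) ^+ 2 / 2) + m * ((x - x0) * (y - y0)).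
have norm_near (a b c t : R) : a <= b <= a + c -> a <= t <= a + c -> `|t - b| <= c.
  by rewrite ler_norml; lra.
have dWx (s t : R) :
    is_derive s 1 (W ^~ t) (P x0 y0 + p * (s - x0) + m * (t - y0)).
  by apply: is_derive_eq; rewrite /GRing.scale/=; field.
have dWy (s t : R) :
    is_derive t 1 (W s) (Q x0 y0 + m * (s - x0) + q * (t - y0)).
  by apply: is_derive_eq; rewrite /GRing.scale/=; field.
have w0 : 0 <= w by lra.
have h0 : 0 <= h by lra.
have Ex t : y <= t <= y + h ->
    `|(PX t (x + w) - PX t x) - (W (x + w) t - W x t)| <= e * (w + h) * w.
  move=> ty; have := @MVT_bound _ (PX t \- W ^~ t) _ x (x + w) (e * (w + h))
    (fun s => is_deriveB (dPX s t) (dWx s t)).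
  rewrite /= (_ : x + w - x = w); last by ring.
  rewrite (ger0_norm w0) (_ : PX t (x + w) - W (x + w) t - (PX t x - W x t) =
    PX t (x + w) - PX t x - (W (x + w) t - W x t)); last by ring.
  apply=> s; rewrite (min_idPl _) ?lerDl// (max_idPr _) ?lerDl// => sx.
  have sd := norm_near _ _ _ _ xx sx; have td := norm_near _ _ _ _ yy ty.
  have [Hs _] := H s t (le_lt_trans sd wd) (le_lt_trans td hd).
  by apply: le_trans Hs _; rewrite ler_pM2l// lerD.
have Ey s : x <= s <= x + w ->
    `|(QY s (y + h) - QY s y) - (W s (y + h) - W s y)| <= e * (w + h) * h.
  move=> sx; have := @MVT_bound _ (QY s \- W s) _ y (y + h) (e * (w + h))
    (fun t => is_deriveB (dQY s t) (dWy s t)).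
  rewrite /= (_ : y + h - y = h); last by ring.
  rewrite (ger0_norm h0) (_ : QY s (y + h) - W s (y + h) - (QY s y - W s y) =
    QY s (y + h) - QY s y - (W s (y + h) - W s y)); last by ring.
  apply=> t; rewrite (min_idPl _) ?lerDl// (max_idPr _) ?lerDl// => ty.
  have sd := norm_near _ _ _ _ xx sx; have td := norm_near _ _ _ _ yy ty.
  have [_ Hs] := H s t (le_lt_trans sd wd) (le_lt_trans td hd).
  by apply: le_trans Hs _; rewrite ler_pM2l// lerD.
have Ex1 := Ex y ltac:(lra); have Ex2 := Ex (y + h) ltac:(lra).
have Ey1 := Ey x ltac:(lra); have Ey2 := Ey (x + w) ltac:(lra).
move: Ex1 Ex2 Ey1 Ey2; rewrite !ler_norml /circulation.
set E1 := e * (w + h) * w; set E2 := e * (w + h) * h.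
have -> : 2 * e * (w + h) ^+ 2 = 2 * E1 + 2 * E2 by rewrite /E1 /E2; ring.
clearbody E1 E2 W; lra.
Qed.

(** The bound is quadratic in the size, hence equal to four times the bound for a
    quarter, while circulations over the quarters add up: the local estimate
    propagates unchanged. *)
Lemma circulation_bound (e x y w h : R) : 0 < e -> 0 <= w -> 0 <= h ->
  `|circulation x y w h| <= 2 * e * (w + h) ^+ 2.
Proof.
move=> e0; move: x y w h.
apply: rectangle_induction; last by move=> x0 y0; exact: circulation_local.
move=> x y w h w0 h0.
have -> : 2 * e * (w + h) ^+ 2 = 4 * (2 * e * (w / 2 + h / 2) ^+ 2) by field.
set E := 2 * e * _ ; rewrite /circulation.
have -> : x + w / 2 + w / 2 = x + w by field.
have -> : y + h / 2 + h / 2 = y + h by field.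
by rewrite !ler_norml; clearbody E; lra.
Qed.

Lemma circulation_eq0 (x y w h : R) : 0 <= w -> 0 <= h ->
  circulation x y w h = 0.
Proof.
move=> w0 h0; apply/eqP; rewrite -normr_eq0; apply/negPn/negP => n0.
have N0 : 0 < `|circulation x y w h| by rewrite lt_neqAle eq_sym n0 normr_ge0.
have S0 : 0 <= (w + h) ^+ 2 by rewrite exprn_ge0// addr_ge0.
have S1 : 0 < 4 * ((w + h) ^+ 2 + 1) by lra.
(* this error constant makes the bound at most half of the modulus, assumed nonzero *)
have a0 := divr_gt0 N0 S1.
have := circulation_bound x y a0 w0 h0.
have := divfK (lt0r_neq0 S1) `|circulation x y w h|.
move: a0; set a := _ / _ => a0; have := mulr_ge0 (ltW a0) S0.
by rewrite !mulrDr mulr1 -mulrA [a * (4 * _)]mulrCA; lra.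
Qed.

(** Integrate vertically from the axis, and horizontally along the axis. The
    derivative in [y] is immediate; vanishing circulations show that integrating
    first vertically and then horizontally gives the same function, whence the
    derivative in [x]. The four cases give each rectangle nonnegative sides. *)
Lemma closed_form_potential :
  exists U : R -> R -> R, forall x y : R,
    is_derive x 1 (U ^~ y) (P x y) /\ is_derive y 1 (U x) (Q x y).
Proof.
exists (fun x y => QY x y + (PX 0 x - QY x 0)) => x y; split; last first.
  exact: is_derive_addc (dQY x y).
suff E s : QY s y + (PX 0 s - QY s 0) = PX y s + (PX 0 0 + QY 0 y - QY 0 0 - PX y 0).
  rewrite (_ : (fun s => _) = fun s => PX y s + (PX 0 0 + QY 0 y - QY 0 0 - PX y 0)).
    exact: is_derive_addc (dPX x y).
  by apply/funext => s; exact: E.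
have [s0|/ltW s0] := leP 0 s; have [y0|/ltW y0] := leP 0 y.
- by have := circulation_eq0 0 0 s0 y0; rewrite /circulation !add0r; lra.
- have := @circulation_eq0 0 y s (- y) s0; rewrite /circulation !add0r subrr oppr_ge0 => /(_ y0); lra.
- have := @circulation_eq0 s 0 (- s) y; rewrite /circulation !add0r subrr oppr_ge0 => /(_ s0 y0); lra.
- have := @circulation_eq0 s y (- s) (- y); rewrite /circulation !subrr !oppr_ge0 => /(_ s0 y0); lra.
Qed.

End goursat.

Lemma closed_continuous_potential (P Q : R -> R -> R) :
  (forall y, continuous (P ^~ y)) -> (forall x, continuous (Q x)) ->
  (forall x y : R, closed_at P Q x y) ->
  exists U : R -> R -> R, forall x y : R,
    is_derive x 1 (U ^~ y) (P x y) /\ is_derive y 1 (U x) (Q x y).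
Proof.
move=> cP cQ PQ.
have [PX dPX] := choice (fun y => antiderivative (cP y)).
have [QY dQY] := choice (fun x => antiderivative (cQ x)).
exact: (closed_form_potential (fun x y => dPX y x) (fun x y => dQY x y) PQ).
Qed.

End closed_forms.

(** * Complex differentiability and primitives *)

Section complex_modulus.
Context (R : realType).
Local Notation C := R[i].
Local Notation normc := (@ComplexField.Normc.normc R).
Local Notation Re := complex.Re.
Local Notation Im := complex.Im.
Implicit Types (z w : C) (x y : R).

Lemma eq_ler x y : x = y -> x <= y.
Proof. by move=> ->. Qed.

Lemma normc_ge0 z : 0 <= normc z.
Proof. by case: z => a b; exact: sqrtr_ge0. Qed.

Lemma normc_real x : normc x%:C = `|x|.
Proof. by rewrite /= expr0n addr0 sqrtr_sqr. Qed.

Lemma normc_norm z : `|z| = (normc z)%:C. Proof. by case: z. Qed.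

Lemma normc_eq0 z : (normc z == 0) = (z == 0).
Proof. by rewrite -(inj_eq (@complexI R)) -normc_norm normr_eq0. Qed.

Lemma normcB z w : normc (z - w) = normc (w - z).
Proof. by rewrite -normcN opprB. Qed.

Lemma normc_triangle z w u : normc (z - u) <= normc (z - w) + normc (w - u).
Proof. by rewrite -[z - u](subrKA w); exact: le_normcD. Qed.

Lemma normr_Re_le z : `|Re z| <= normc z.
Proof.
case: z => a b /=; rewrite -sqrtr_sqr ler_wsqrtr// lerDl sqr_ge0//.
Qed.

Lemma normr_Im_le z : `|Im z| <= normc z.
Proof.
by case: z => a b /=; rewrite -sqrtr_sqr ler_wsqrtr// lerDr sqr_ge0.
Qed.

Lemma normc_le_ReIm z : normc z <= `|Re z| + `|Im z|.
Proof.
case: z => a b /=; rewrite -[leRHS]ger0_norm ?addr_ge0// -sqrtr_sqr ler_wsqrtr//.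
by rewrite sqrrD !real_normK ?num_real// lerD2r lerDl mulrn_wge0 ?mulr_ge0.
Qed.

Lemma posc_real (e : C) : 0 < e -> exists2 x : R, 0 < x & e = x%:C.
Proof.
by case: e => a b; rewrite ltcE/= => /andP[/eqP-> a0]; exists a.
Qed.

End complex_modulus.

Section complex_derivative.
Context (R : realType).
Local Notation C := R[i].
Local Notation normc := (@ComplexField.Normc.normc R).
Local Notation Re := complex.Re.
Local Notation Im := complex.Im.
Implicit Types (f g : C -> C) (z w h d : C).

(** Complex differentiability with increments measured by the real-valued modulus,
    so that all later estimates take place in [R]. *)
Definition cderiv f z d : Prop := forall e : R, 0 < e ->
  exists2 c : R, 0 < c & forall h : C, normc h < c ->
    normc (f (z + h) - f z - d * h) <= e * normc h.

Lemma cderivP f z d :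
  h^-1 *: ((f : C^o -> C^o) (h *: 1 + z) - f z) @[h --> (0 : C^o)^'] --> (d : C^o)
    <-> cderiv f z d.
Proof.
split=> [/cvgrPdist_le H e e0|H].
  have e0C : 0 < e%:C by rewrite ltcR.
  have /nbhs_ballP[c /= /posc_real[a a0 ->{c}] Hc] := H _ e0C.
  exists a => // h ha; have [->|h0] := eqVneq h 0.
    by rewrite mulr0 subr0 addr0 subrr !ComplexField.Normc.normc0 mulr0.
  have := Hc h; rewrite /ball/= sub0r normrN normc_norm ltcR => /(_ ha h0).
  rewrite -[_ *: _ in X in X -> _]/(h^-1 * _) -[_%:A]/(h * 1) mulr1.
  rewrite normc_norm lecR => Hh.
  have -> : f (z + h) - f z - d * h = - (d - h^-1 * (f (h + z) - f z)) * h.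
    by rewrite (addrC z h); field.
  by rewrite ComplexField.Normc.normcM normcN ler_wpM2r// normc_ge0.
apply/cvgrPdist_le => _ /posc_real[e e0 ->]; have [c c0 Hc] := H _ e0.
apply/nbhs_ballP; exists c%:C => /=; first by rewrite ltcR.
move=> h; rewrite /ball/= sub0r normrN normc_norm ltcR => hc h0.
rewrite -[_ *: _]/(h^-1 * _) -[_%:A]/(h * 1) mulr1 normc_norm lecR.
have := Hc _ hc.
have -> : f (z + h) - f z - d * h = - (d - h^-1 * (f (h + z) - f z)) * h.
  by rewrite (addrC z h); field.
rewrite ComplexField.Normc.normcM normcN ler_pM2r//.
by rewrite lt_neqAle normc_ge0 eq_sym normc_eq0 h0.
Qed.

Lemma entireP f : entire f <-> forall z, exists d, cderiv f z d.
Proof.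
split=> [fe z|H z].
  have : derivable (f : C^o -> C^o) z 1 := fe z.
  by move=> /cvg_ex[d /cderivP]; exists d.
by have [d /cderivP fd] := H z; apply/cvg_ex; exists d.
Qed.

Definition ccontinuous f : Prop := forall (z : C) (e : R), 0 < e ->
  exists2 c : R, 0 < c & forall h : C, normc h < c -> normc (f (z + h) - f z) <= e.

Lemma cderiv_continuous f (d : C -> C) :
  (forall z, cderiv f z (d z)) -> ccontinuous f.
Proof.
move=> fd z e e0; have [c c0 Hc] := fd z 1 ltr01.
have D0 : 0 < 1 + normc (d z) by have := normc_ge0 (d z); lra.
exists (Num.min c (e / (1 + normc (d z)))).
  by rewrite lt_min c0 divr_gt0.
move=> h; rewrite lt_min => /andP[/Hc{}Hc]; rewrite ltr_pdivlMr// => he.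
rewrite -[_ - _](subrK (d z * h)); apply: le_trans (le_normcD _ _) _.
rewrite ComplexField.Normc.normcM; lra.
Qed.

Lemma entire_continuous f : entire f -> ccontinuous f.
Proof. by move=> /entireP/choice[d /cderiv_continuous]. Qed.

Lemma cderiv_mulr f z d (a : C) : cderiv f z d -> cderiv (fun w => f w * a) z (d * a).
Proof.
move=> fd e e0; have a1 : 0 < 1 + normc a by have := normc_ge0 a; lra.
have [c c0 Hc] := fd _ (divr_gt0 e0 a1); exists c => // h /Hc.
rewrite (_ : f (z + h) * a - f z * a - d * a * h = (f (z + h) - f z - d * h) * a); last by ring.
rewrite ComplexField.Normc.normcM => /(ler_wpM2r (normc_ge0 a))/le_trans; apply.
rewrite mulrAC ler_wpM2r ?normc_ge0// mulrAC ler_pdivrMr// ler_pM2l//; lra.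
Qed.

(** Complex derivatives are used through real parts along segments, where the real
    mean value inequality is available. *)
Lemma is_derive_Re_line f (d : C -> C) (z a : C) (s : R) :
  (forall z, cderiv f z (d z)) ->
  is_derive s 1 (fun t : R => Re (f (z + t%:C * a))) (Re (d (z + s%:C * a) * a)).
Proof.
move=> fd; apply/is_derive_eps => e e0.
have a1 : 0 < 1 + normc a by have := normc_ge0 a; lra.
have [c c0 Hc] := fd (z + s%:C * a) _ (divr_gt0 e0 a1).
exists (c / (1 + normc a)) => [|h]; first by rewrite divr_gt0.
rewrite ltr_pdivlMr// => hc.
have ha : normc (h%:C * a) < c.
  apply: le_lt_trans hc; rewrite ComplexField.Normc.normcM normc_real ler_wpM2l//; lra.
have := Hc _ ha; set D := f _ - _ - _ => HD.
have -> : Re (f (z + (s + h)%:C * a)) - Re (f (z + s%:C * a))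
    - Re (d (z + s%:C * a) * a) * h = Re D.
  rewrite /D (_ : z + s%:C * a + h%:C * a = z + (s + h)%:C * a); last first.
    by rewrite rmorphD/=; ring.
  rewrite [d _ * (_ * _)]mulrCA; move: (f _) (f _) (d _ * a) => [? ?] [? ?] [? ?] /=.
  by ring.
apply: le_trans (normr_Re_le _) _; apply: le_trans HD _.
rewrite ComplexField.Normc.normcM normc_real.
have -> : e / (1 + normc a) * (`|h| * normc a) = e * `|h| * (normc a / (1 + normc a)).
  by ring.
by rewrite ler_piMr ?mulr_ge0 ?(ltW e0)// ler_pdivrMr//; lra.
Qed.

Lemma continuous_ReIm (k : R -> C) :
  (forall x0 e : R, 0 < e -> exists2 c : R, 0 < c & forall x : R,
    `|x - x0| < c -> normc (k x - k x0) <= e) ->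
  continuous (fun x => Re (k x)) /\ continuous (fun x => Im (k x)).
Proof.
move=> H; split=> x0.
  apply/cvgrPdist_le => e e0; have [c c0 Hc] := H x0 e e0.
  apply/nbhs_ballP; exists c => //= x; rewrite /ball/= distrC => /Hc.
  apply: le_trans; rewrite distrC; apply: le_trans (normr_Re_le _).
  by case: (k x) (k x0) => [? ?] [? ?].
apply/cvgrPdist_le => e e0; have [c c0 Hc] := H x0 e e0.
apply/nbhs_ballP; exists c => //= x; rewrite /ball/= distrC => /Hc.
apply: le_trans; rewrite distrC; apply: le_trans (normr_Im_le _).
by case: (k x) (k x0) => [? ?] [? ?].
Qed.

(** With [f = u + i v], the Cauchy-Riemann equations make [u dx - v dy] and
    [v dx + u dy] closed. Potentials [U] and [V] of these forms are the real and
    imaginary parts of the primitive; its complex differentiability follows from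
    the mean value inequality along a horizontal and a vertical segment. *)
Lemma primitive f : entire f -> exists F : C -> C, forall z, cderiv F z (f z).
Proof.
move=> fe; have cf := entire_continuous fe.
have small (a b c : R) : `|a| < c / 2 -> `|b| < c / 2 -> normc (a +i* b) < c.
  move=> ha hb; apply: le_lt_trans (normc_le_ReIm _) _ => /=; lra.
have shift (x y a b : R) : (x +i* y) + ((a - x) +i* (b - y)) = a +i* b.
  by apply/eqP; rewrite eq_complex/= !subrKC !eqxx.
have cx (y : R) : forall x0 e : R, 0 < e -> exists2 c : R, 0 < c & forall x : R,
    `|x - x0| < c -> normc (f (x +i* y) - f (x0 +i* y)) <= e.
  move=> x0 e e0; have [c c0 Hc] := cf (x0 +i* y) e e0; exists (c / 2); first lra.
  move=> x xc; have := Hc ((x - x0) +i* (y - y)); rewrite shift; apply.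
  by apply: small; rewrite // subrr normr0; lra.
have cy (x : R) : forall y0 e : R, 0 < e -> exists2 c : R, 0 < c & forall y : R,
    `|y - y0| < c -> normc (f (x +i* y) - f (x +i* y0)) <= e.
  move=> y0 e e0; have [c c0 Hc] := cf (x +i* y0) e e0; exists (c / 2); first lra.
  move=> y yc; have := Hc ((x - x) +i* (y - y0)); rewrite shift; apply.
  by apply: small; rewrite // subrr normr0; lra.
(* the Cauchy-Riemann equations make both u dx - v dy and v dx + u dy closed *)
have CR (x0 y0 : R) : exists d1 d2 : R, forall e : R, 0 < e -> exists2 c : R, 0 < c &
    forall x y : R, `|x - x0| < c -> `|y - y0| < c ->
    `|Re (f (x +i* y)) - (Re (f (x0 +i* y0)) + d1 * (x - x0) + - d2 * (y - y0))|
      <= e * (`|x - x0| + `|y - y0|) /\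
    `|Im (f (x +i* y)) - (Im (f (x0 +i* y0)) + d2 * (x - x0) + d1 * (y - y0))|
      <= e * (`|x - x0| + `|y - y0|).
  have /entireP/(_ (x0 +i* y0))[[d1 d2] fd] := fe; exists d1, d2 => e e0.
  have [c c0 Hc] := fd e e0; exists (c / 2) => [|x y xc yc]; first lra.
  have := Hc ((x - x0) +i* (y - y0)) (small _ _ _ xc yc); rewrite shift.
  have : e * normc ((x - x0) +i* (y - y0)) <= e * (`|x - x0| + `|y - y0|).
    by rewrite ler_pM2l// normc_le_ReIm.
  move=> h1 /le_trans/(_ h1){h1} h2.
  split; [apply: le_trans h2|apply: le_trans h2].
    apply: le_trans (normr_Re_le _); apply: eq_ler; congr `|_|.
    by case: (f _) (f _) => [? ?] [? ?] /=; ring.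
  apply: le_trans (normr_Im_le _); apply: eq_ler; congr `|_|.
  by case: (f _) (f _) => [? ?] [? ?] /=; ring.
have [U dU] : exists U : R -> R -> R, forall x y : R,
    is_derive x 1 (U ^~ y) (Re (f (x +i* y))) /\
    is_derive y 1 (U x) (- Im (f (x +i* y))).
  apply: (@closed_continuous_potential _ (fun x y => Re (f (x +i* y)))
                                         (fun x y => - Im (f (x +i* y)))).
  - by move=> y; case: (continuous_ReIm (cx y)).
  - move=> x y; have [_ cI] := continuous_ReIm (cy x).
    exact: (continuous_comp (cI y) (@oppr_continuous R R _)).
  move=> x0 y0; have [d1 [d2 H]] := CR x0 y0; exists d1, (- d2), (- d1) => e e0.
  have [c c0 Hc] := H e e0; exists c => // x y xc yc.
  have [h1 h2] := Hc x y xc yc; split=> //; rewrite -normrN.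
  by apply: le_trans h2; apply: eq_ler; congr `|_|; ring.
have [V dV] : exists V : R -> R -> R, forall x y : R,
    is_derive x 1 (V ^~ y) (Im (f (x +i* y))) /\
    is_derive y 1 (V x) (Re (f (x +i* y))).
  apply: (@closed_continuous_potential _ (fun x y => Im (f (x +i* y)))
                                         (fun x y => Re (f (x +i* y)))).
  - by move=> y; case: (continuous_ReIm (cx y)).
  - by move=> x; case: (continuous_ReIm (cy x)).
  move=> x0 y0; have [d1 [d2 H]] := CR x0 y0; exists d2, d1, (- d2) => e e0.
  have [c c0 Hc] := H e e0; exists c => // x y xc yc.
  by have [h1 h2] := Hc x y xc yc.
exists (fun z => U (Re z) (Im z) +i* V (Re z) (Im z)) => -[x y] e e0.
have e4 : 0 < e / 4 by lra.
have [c c0 Hc] := cf (x +i* y) _ e4; exists (c / 2) => [|[a b] hc]; first lra.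
have ac : `|a| <= normc (a +i* b) := normr_Re_le (a +i* b).
have bc : `|b| <= normc (a +i* b) := normr_Im_le (a +i* b).
move: hc ac bc; set N := normc (a +i* b) => hc ac bc.
have near (s t : R) : `|s - x| <= `|a| -> `|t - y| <= `|b| ->
    `|Re (f (s +i* t)) - Re (f (x +i* y))| <= e / 4 /\
    `|Im (f (s +i* t)) - Im (f (x +i* y))| <= e / 4.
  move=> sx ty; have := Hc ((s - x) +i* (t - y)); rewrite shift => H.
  have {}H : normc (f (s +i* t) - f (x +i* y)) <= e / 4.
    by apply: H; apply: small; lra.
  split; [apply: le_trans H|apply: le_trans H].
    by apply: le_trans (normr_Re_le _); case: (f _) (f _) => [? ?] [? ?].
  by apply: le_trans (normr_Im_le _); case: (f _) (f _) => [? ?] [? ?].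
have between (p q s : R) : Num.min p (p + q) <= s <= Num.max p (p + q) -> `|s - p| <= `|q|.
  by case: (ger0P q) => ?; case: (leP p (p + q)) => ? /andP[? ?]; rewrite ler_norml; lra.
have lin (k : R) (s : R) : is_derive s 1 (fun t : R => k * t) k.
  by apply: is_derive_eq; rewrite /GRing.scale/= mulr1.
have seg (K k : R -> R) (p q l : R) : (forall s : R, is_derive s 1 K (k s)) ->
    (forall s : R, `|s - p| <= `|q| -> `|k s - l| <= e / 4) ->
    `|q| <= N ->
    `|K (p + q) - K p - l * q| <= e / 4 * N.
  move=> dK kl qn.
  have := @MVT_bound _ (K \- (fun t => l * t)) _ p (p + q) (e / 4)
    (fun s => is_deriveB (dK s) (lin l s)).
  rewrite /= (_ : K (p + q) - l * (p + q) - (K p - l * p) = K (p + q) - K p - l * q); last by ring.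
  rewrite (_ : p + q - p = q); last by ring.
  move=> /(_ (fun s sp => kl s (between _ _ _ sp))).
  by move/le_trans; apply; rewrite ler_wpM2l//; lra.
have xa : `|x + a - x| <= `|a| by rewrite addrC addKr.
have yy : `|y - y| <= `|b| by rewrite subrr normr0.
have U1 := seg _ _ x a (Re (f (x +i* y))) (fun s => (dU s y).1)
  (fun s sx => (near s y sx yy).1) ac.
have V1 := seg _ _ x a (Im (f (x +i* y))) (fun s => (dV s y).1)
  (fun s sx => (near s y sx yy).2) ac.
have V2 := seg _ _ y b (Re (f (x +i* y))) (fun t => (dV (x + a) t).2)
  (fun t ty => (near (x + a) t xa ty).1) bc.
have U2 : `|U (x + a) (y + b) - U (x + a) y - (- Im (f (x +i* y))) * b|
    <= e / 4 * N.
  apply: seg (fun t => (dU (x + a) t).2) _ bc => t ty.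
  by rewrite opprK addrC distrC; exact: (near (x + a) t xa ty).2.
apply: le_trans (normc_le_ReIm _) _.
have add2 (p q r M : R) : `|p| <= M -> `|q| <= M -> r = p + q -> `|r| <= 2 * M.
  by rewrite !ler_norml => ? ? ->; lra.
rewrite (_ : e * N = 2 * (e / 4 * N) + 2 * (e / 4 * N)); last by field.
by apply: lerD; [apply: add2 U1 U2 _|apply: add2 V1 V2 _];
  case: (f _) => u v /=; ring.
Qed.

End complex_derivative.

(** * Compactness of discs *)

Section compactness.
Context (R : realType).
Local Notation C := R[i].
Local Notation normc := (@ComplexField.Normc.normc R).
Local Notation Re := complex.Re.
Local Notation Im := complex.Im.
Implicit Types (f g : C -> C) (z w h d : C).

(** Compactness of closed discs: enclose the disc in a square and bisect. *)
Lemma disc_induction (P : (C -> Prop) -> Prop) :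
  (forall A B : C -> Prop, P A -> P B -> P (fun z => A z \/ B z)) ->
  (forall A B : C -> Prop, (forall z, A z -> B z) -> P B -> P A) ->
  (forall z : C, exists2 c : R, 0 < c & P (fun w => normc (w - z) < c)) ->
  forall r : R, P (fun z => normc z <= r).
Proof.
move=> PU PS Ploc r; have [r0|r0] := ltP r 0.
  have [c c0 /PS] := Ploc 0; apply=> z zr.
  by have := le_lt_trans (le_trans (normc_ge0 z) zr) r0; rewrite ltxx.
pose box (x y w h : R) (z : C) : Prop :=
  x <= Re z <= x + w /\ y <= Im z <= y + h.
suff : forall x y w h : R, 0 <= w -> 0 <= h -> P (box x y w h).
  move=> /(_ (- r) (- r) (2 * r) (2 * r) ltac:(lra) ltac:(lra)).
  apply: PS => z zr; have := le_trans (normr_Re_le z) zr.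
  by have := le_trans (normr_Im_le z) zr; rewrite !ler_norml /box; lra.
apply: rectangle_induction => [x y w h w0 h0 P1 P2 P3 P4|x0 y0].
  apply: PS (PU _ _ (PU _ _ P1 P2) (PU _ _ P3 P4)) => z [zx zy].
  have [ax|ax] := leP (Re z) (x + w / 2); have [ay|ay] := leP (Im z) (y + h / 2).
  - by left; left; split; lra.
  - by right; left; split; lra.
  - by left; right; split; lra.
  - by right; right; split; lra.
have [c c0 Pc] := Ploc (x0 +i* y0); exists (c / 2) => [|x y w h xx yy wc hc]; first lra.
apply: PS Pc => -[a b] [zx zy]; rewrite /= in zx zy.
apply: le_lt_trans (normc_le_ReIm _) _ => /=.
have : `|a - x0| <= w by rewrite ler_norml; lra.
have : `|b - y0| <= h by rewrite ler_norml; lra.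
lra.
Qed.

Lemma ccontinuous_unif f (r e : R) : ccontinuous f -> 0 < e ->
  exists2 c : R, 0 < c & forall z h, normc z <= r -> normc h < c ->
    normc (f (z + h) - f z) <= e.
Proof.
move=> cf e0.
apply: (@disc_induction (fun A => exists2 c : R, 0 < c & forall z h, A z -> normc h < c ->
    normc (f (z + h) - f z) <= e)).
- move=> A B [a a0 HA] [b b0 HB]; exists (Num.min a b); first by rewrite lt_min a0.
  by move=> z h [Az|Bz]; rewrite lt_min => /andP[? ?]; [exact: HA|exact: HB].
- by move=> A B AB [b b0 HB]; exists b => // z h /AB; exact: HB.
move=> z; have e2 : 0 < e / 2 by lra.
have [c c0 Hc] := cf z _ e2; exists (c / 2); first lra.
exists (c / 2) => [|w h wz hc]; first lra.
have H1 := Hc (w + h - z); have H2 := Hc (w - z); rewrite !subrKC in H1 H2.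
rewrite (normcB (f w)) in H2.
apply: le_trans (normc_triangle _ (f z) _) _.
have : normc (w + h - z) < c.
  by rewrite -addrA addrCA; apply: le_lt_trans (le_normcD _ _) _; lra.
by move=> /H1; have := H2 ltac:(lra); lra.
Qed.

Lemma ccontinuous_bounded f (r : R) : ccontinuous f ->
  exists M : R, forall z, normc z <= r -> normc (f z) <= M.
Proof.
move=> cf.
apply: (@disc_induction (fun A => exists M : R, forall z, A z -> normc (f z) <= M)).
- move=> A B [a HA] [b HB]; exists (Num.max a b).
  by move=> z [/HA|/HB]; rewrite le_max => ->; rewrite ?orbT.
- by move=> A B AB [b HB]; exists b => // z /AB; exact: HB.
move=> z; have [c c0 Hc] := cf z _ ltr01; exists c => //.
exists (1 + normc (f z)) => w /Hc; rewrite subrKC => H.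
by rewrite -[f w](subrK (f z)); apply: le_trans (le_normcD _ _) _; lra.
Qed.

End compactness.

(** * The four-point mean property *)

Section four_point.
Context (R : realType).
Local Notation C := R[i].
Local Notation normc := (@ComplexField.Normc.normc R).
Local Notation Re := complex.Re.
Local Notation Im := complex.Im.
Implicit Types (f g : C -> C) (z w h d : C).

(** Four times the difference between the average of [f] over the vertices of a
    square and its value at the centre; for smooth [f] this is
    [|h|^2 (Laplacian f)(z) + o(|h|^2)]. *)
Definition star_difference f z h : C :=
  f (z + h) + f (z - h) + f (z + 'i * h) + f (z - 'i * h) - 4%:R * f z.

(** An infinitesimal mean value property, which for twice differentiable functions
    would mean harmonicity. It is locally uniform because the proof of the maximum
    principle needs it at a point and simultaneously on a whole circle. *)
Definition four_point_mean f : Prop := forall r e : R, 0 < e ->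
  exists2 c : R, 0 < c & forall z h, normc z <= r -> normc h < c ->
    normc (star_difference f z h) <= e * normc h ^+ 2.

Lemma four_point_meanD f g : four_point_mean f -> four_point_mean g ->
  four_point_mean (fun z => f z + g z).
Proof.
move=> mf mg r e e0; have e2 : 0 < e / 2 by lra.
have [a a0 Ha] := mf r _ e2; have [b b0 Hb] := mg r _ e2.
exists (Num.min a b) => [|z h zr]; first by rewrite lt_min a0.
rewrite lt_min => /andP[/(Ha _ _ zr){}Ha /(Hb _ _ zr){}Hb].
have -> : star_difference (fun z => f z + g z) z h = star_difference f z h + star_difference g z h.
  by rewrite /star_difference; ring.
by apply: le_trans (le_normcD _ _) _; lra.
Qed.

Lemma four_point_mean_affine f (a b k : C) : four_point_mean f ->
  four_point_mean (fun z => k * f (a * z + b)).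
Proof.
move=> mf r e e0; have k1 : 0 < 1 + normc k by have := normc_ge0 k; lra.
have a1 : 0 < 1 + normc a by have := normc_ge0 a; lra.
have ka : 0 < (1 + normc k) * (1 + normc a) ^+ 2 by rewrite mulr_gt0// exprn_gt0.
have [c c0 Hc] := mf (normc a * r + normc b) _ (divr_gt0 e0 ka).
exists (c / (1 + normc a)) => [|z h zr]; first by rewrite divr_gt0.
rewrite ltr_pdivlMr// => hc.
have zr' : normc (a * z + b) <= normc a * r + normc b.
  apply: le_trans (le_normcD _ _) _; rewrite lerD2r ComplexField.Normc.normcM.
  by rewrite ler_wpM2l// normc_ge0.
have hc' : normc (a * h) < c.
  rewrite ComplexField.Normc.normcM; apply: le_lt_trans hc.
  by rewrite mulrC ler_wpM2l ?normc_ge0//; lra.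
have -> : star_difference (fun z => k * f (a * z + b)) z h = k * star_difference f (a * z + b) (a * h).
  have E u : a * (z + u) + b = a * z + b + a * u by ring.
  by rewrite /star_difference !E !(mulrN a) (mulrCA a 'i h); ring.
rewrite ComplexField.Normc.normcM.
have := Hc _ _ zr' hc'; rewrite ComplexField.Normc.normcM => H.
apply: le_trans (ler_wpM2l (normc_ge0 k) H) _.
have -> : normc k * (e / ((1 + normc k) * (1 + normc a) ^+ 2) * (normc a * normc h) ^+ 2)
    = e * normc h ^+ 2 * ((normc k * normc a ^+ 2) / ((1 + normc k) * (1 + normc a) ^+ 2)).
  by ring.
rewrite ler_piMr ?mulr_ge0 ?exprn_ge0 ?(ltW e0) ?normc_ge0// ler_pdivrMr// mul1r.
have k0 := normc_ge0 k; have a0 := normc_ge0 a.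
by apply: ler_pM; rewrite ?exprn_ge0//; [lra|rewrite lerXn2r ?nnegrE//; lra].
Qed.

Lemma ccontinuousD f g : ccontinuous f -> ccontinuous g ->
  ccontinuous (fun z => f z + g z).
Proof.
move=> cf cg z e e0; have e2 : 0 < e / 2 by lra.
have [a a0 Ha] := cf z _ e2; have [b b0 Hb] := cg z _ e2.
exists (Num.min a b) => [|h]; first by rewrite lt_min a0.
rewrite lt_min => /andP[/Ha{}Ha /Hb{}Hb].
rewrite opprD addrACA; apply: le_trans (le_normcD _ _) _; lra.
Qed.

Lemma ccontinuous_affine f (a b k : C) : ccontinuous f ->
  ccontinuous (fun z => k * f (a * z + b)).
Proof.
move=> cf z e e0; have k1 : 0 < 1 + normc k by have := normc_ge0 k; lra.
have a1 : 0 < 1 + normc a by have := normc_ge0 a; lra.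
have [c c0 Hc] := cf (a * z + b) _ (divr_gt0 e0 k1).
exists (c / (1 + normc a)) => [|h]; first by rewrite divr_gt0.
rewrite ltr_pdivlMr// => hc.
have hc' : normc (a * h) < c.
  rewrite ComplexField.Normc.normcM; apply: le_lt_trans hc.
  by rewrite mulrC ler_wpM2l ?normc_ge0//; lra.
rewrite -mulrBr ComplexField.Normc.normcM (_ : a * (z + h) + b = a * z + b + a * h); last by ring.
have /(ler_wpM2l (normc_ge0 k)) H := Hc _ hc'; apply: le_trans H _.
by rewrite mulrA ler_pdivrMr// mulrC ler_pM2l//; lra.
Qed.

(** The second derivative along the segment from [z] in direction [i^j h] is
    [i^(2j) h^2 f]; the signs [1, -1, 1, -1] cancel it up to the oscillation of [f]
    near [z], and the first derivatives at [z] cancel as well. *)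
Lemma four_point_second_primitive f F G :
  ccontinuous f -> (forall z, cderiv F z (f z)) -> (forall z, cderiv G z (F z)) ->
  four_point_mean G.
Proof.
move=> cf dF dG r e e0; have e8 : 0 < e / 8 by lra.
have [c c0 Hc] := ccontinuous_unif r cf e8.
exists c => // z h zr hc.
(* both real coordinates are handled at once by testing against [a] *)
suff Hre (a : C) : normc a <= 1 -> `|Re (a * star_difference G z h)| <= e / 2 * normc h ^+ 2.
  apply: le_trans (normc_le_ReIm _) _.
  have := Hre 1 ltac:(by rewrite ComplexField.Normc.normc1).
  have := Hre (- 'i)%C ltac:(by rewrite normcN /= expr0n expr1n add0r sqrtr1).
  by rewrite mul1r; case: (star_difference G z h) => x y /=; rewrite oppr0 !mul0r !mulN1r opprK add0r; lra.
move=> a1.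
pose dir (j : nat) : C := 'i ^+ j * h.
have dirN j : normc (dir j) = normc h.
  rewrite /dir ComplexField.Normc.normcM; suff -> : normc ('i ^+ j) = 1 by rewrite mul1r.
  elim: j => [|j IH]; first exact: ComplexField.Normc.normc1.
  rewrite exprS ComplexField.Normc.normcM IH mulr1 /= expr0n expr1n add0r sqrtr1//.
pose line (g : C -> C) (j : nat) (s : R) : R := Re (g (z + s%:C * dir j)).
have dline1 j (s : R) : is_derive s 1 (line (fun w => G w * a) j)
    (line (fun w => F w * a * dir j) j s).
  rewrite /line; exact: (@is_derive_Re_line _ (fun w => G w * a) (fun w => F w * a) z (dir j) s
    (fun w => cderiv_mulr a (dG w))).
have dline2 j (s : R) : is_derive s 1 (line (fun w => F w * a * dir j) j)
    (line (fun w => f w * a * dir j * dir j) j s).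
  rewrite /line; exact: (@is_derive_Re_line _ (fun w => F w * a * dir j) (fun w => f w * a * dir j)
    z (dir j) s (fun w => cderiv_mulr _ (cderiv_mulr a (dF w)))).
(* psi is the real part of a times the sum of G over the four moving points;
   psi1 and psi2 are its first two derivatives *)
pose psi (s : R) := line (fun w => G w * a) 0 s + line (fun w => G w * a) 2 s
  + line (fun w => G w * a) 1 s + line (fun w => G w * a) 3 s.
pose psi1 (s : R) := line (fun w => F w * a * dir 0) 0 s + line (fun w => F w * a * dir 2) 2 s
  + line (fun w => F w * a * dir 1) 1 s + line (fun w => F w * a * dir 3) 3 s.
pose psi2 (s : R) := line (fun w => f w * a * dir 0 * dir 0) 0 s
  + line (fun w => f w * a * dir 2 * dir 2) 2 s
  + line (fun w => f w * a * dir 1 * dir 1) 1 s + line (fun w => f w * a * dir 3 * dir 3) 3 s.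
have dpsi (s : R) : is_derive s 1 psi (psi1 s).
  exact: is_deriveD (is_deriveD (is_deriveD (dline1 0%N s) (dline1 2%N s)) (dline1 1%N s)) (dline1 3%N s).
have dpsi1 (s : R) : is_derive s 1 psi1 (psi2 s).
  exact: is_deriveD (is_deriveD (is_deriveD (dline2 0%N s) (dline2 2%N s)) (dline2 1%N s)) (dline2 3%N s).
have i2 : 'i * 'i = -1 :> C by rewrite -expr2 sqr_i.
have dir0 : dir 0%N = h by rewrite /dir mul1r.
have dir1 : dir 1%N = 'i * h by rewrite /dir.
have dir2 : dir 2%N = - h by rewrite /dir expr2 i2 mulN1r.
have dir3 : dir 3%N = - ('i * h) by rewrite /dir exprS expr2 i2 mulrN1 mulNr.
have psi10 : psi1 0 = 0.
  rewrite /psi1 /line !mul0r !addr0 dir0 dir1 dir2 dir3 -!raddfD/=.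
  by rewrite (_ : _ + _ = 0) //; ring.
have bound2 (s : R) : `|s| <= 1 -> `|psi2 s| <= e / 2 * normc h ^+ 2.
  move=> s1.
  have near j : normc (f (z + s%:C * dir j) - f z) <= e / 8.
    apply: Hc => //; rewrite ComplexField.Normc.normcM normc_real dirN.
    by apply: le_lt_trans hc; rewrite ler_piMl// normc_ge0.
  have -> : psi2 s = Re (((f (z + s%:C * dir 0) - f z) + (f (z + s%:C * dir 2) - f z)
      - (f (z + s%:C * dir 1) - f z) - (f (z + s%:C * dir 3) - f z)) * (a * (h * h))).
    have sq : 'i * h * ('i * h) = - (h * h) by rewrite mulrACA i2 mulN1r.
    have d0 : dir 0%N * dir 0%N = h * h by rewrite dir0.
    have d1 : dir 1%N * dir 1%N = - (h * h) by rewrite dir1.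
    have d2 : dir 2%N * dir 2%N = h * h by rewrite dir2 mulrNN.
    have d3 : dir 3%N * dir 3%N = - (h * h) by rewrite dir3 mulrNN.
    rewrite /psi2 /line -!raddfD/=; congr Re.
    rewrite -(mulrA _ (dir 0%N) (dir 0%N)) -(mulrA _ (dir 1%N) (dir 1%N)).
    rewrite -(mulrA _ (dir 2%N) (dir 2%N)) -(mulrA _ (dir 3%N) (dir 3%N)).
    by rewrite d0 d1 d2 d3; ring.
  apply: le_trans (normr_Re_le _) _; rewrite !ComplexField.Normc.normcM.
  have h2 : 0 <= normc h * normc h by rewrite mulr_ge0 ?normc_ge0.
  have ah : normc a * (normc h * normc h) <= normc h ^+ 2.
    by rewrite expr2 ler_piMl.
  apply: le_trans (_ : e / 2 * (normc a * (normc h * normc h)) <= _); last by rewrite ler_pM2l//; lra.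
  apply: ler_wpM2r; first by rewrite mulr_ge0 ?normc_ge0.
  apply: le_trans (le_normcD _ _) _; rewrite normcN.
  apply: (le_trans (lerD (le_normcD _ _) (lexx _))); rewrite normcN.
  apply: (le_trans (lerD (lerD (le_normcD _ _) (lexx _)) (lexx _))).
  by have := near 0%N; have := near 1%N; have := near 2%N; have := near 3%N; lra.
have bound1 (s : R) : 0 <= s <= 1 -> `|psi1 s| <= e / 2 * normc h ^+ 2.
  move=> s01; have [s0 s1] := andP s01.
  have := @MVT_bound _ psi1 psi2 0 s (e / 2 * normc h ^+ 2) dpsi1.
  rewrite psi10 !subr0 (min_idPl s0) (max_idPr s0) => H.
  have M0 : 0 <= e / 2 * normc h ^+ 2 by rewrite mulr_ge0 ?exprn_ge0 ?normc_ge0//; lra.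
  apply: le_trans (H _) _; last by rewrite ler_piMr// ger0_norm.
  by move=> t ts; apply: bound2; rewrite ler_norml; lra.
have := @MVT_bound _ psi psi1 0 1 (e / 2 * normc h ^+ 2) dpsi.
rewrite subr0 normr1 mulr1 (min_idPl ler01) (max_idPr ler01) => /(_ bound1).
suff -> : psi 1 - psi 0 = Re (a * star_difference G z h) by [].
rewrite /psi /line !mul0r !mul1r !addr0 dir0 dir1 dir2 dir3 -!raddfD -raddfB/=.
by congr Re; rewrite /star_difference; ring.
Qed.

(** [f] is the second derivative of [G], hence the locally uniform limit of its
    second difference quotients: apply the mean value inequality twice. *)
Lemma second_difference_cvg f F G (r e : R) : ccontinuous f ->
  (forall z, cderiv F z (f z)) -> (forall z, cderiv G z (F z)) -> 0 < e ->
  exists2 d : R, 0 < d & forall z, normc z <= r ->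
    normc ((d%:C ^+ 2)^-1 * (G (z + 2 * d%:C) - 2 * G (z + d%:C) + G z) - f z) <= e.
Proof.
move=> cf dF dG e0; have e2 : 0 < e / 2 by lra.
have [c c0 Hc] := ccontinuous_unif r cf e2.
(* the second difference only involves points at distance at most 2 d from z *)
pose d := c / 4; have d0 : 0 < d by rewrite /d; lra.
exists d => // z zr.
have dC : d%:C != 0 :> C by rewrite -(rmorph0 (@real_complex R)) (inj_eq (@complexI R)) gt_eqF.
set D := G _ - _ + _.
suff Hre (a : C) : normc a <= 1 -> `|Re (a * (D - d%:C ^+ 2 * f z))| <= e / 2 * d ^+ 2.
  rewrite (_ : _ - f z = (d%:C ^+ 2)^-1 * (D - d%:C ^+ 2 * f z)); last by field.
  rewrite ComplexField.Normc.normcM ComplexField.Normc.normcV.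
  have -> : normc (d%:C ^+ 2) = d ^+ 2.
    by rewrite expr2 ComplexField.Normc.normcM normc_real (ger0_norm (ltW d0)).
  rewrite mulrC ler_pdivrMr ?exprn_gt0//.
  apply: le_trans (normc_le_ReIm _) _.
  have := Hre 1 ltac:(by rewrite ComplexField.Normc.normc1).
  have := Hre (- 'i)%C ltac:(by rewrite normcN /= expr0n expr1n add0r sqrtr1).
  rewrite mul1r; case: (D - _) => x y /=.
  by rewrite oppr0 !mul0r !mulN1r opprK add0r; lra.
move=> a1.
pose line (g : C -> C) (w : C) (s : R) : R := Re (g (w + s%:C * 1)).
have dG' w (s : R) : is_derive s 1 (line (fun w => G w * a) w) (line (fun w => F w * a * 1) w s).
  rewrite /line; exact: (@is_derive_Re_line _ (fun w => G w * a) (fun w => F w * a) w 1 s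
    (fun w => cderiv_mulr a (dG w))).
have dF' w (s : R) : is_derive s 1 (line (fun w => F w * a * 1) w) (line (fun w => f w * a * 1 * 1) w s).
  rewrite /line; exact: (@is_derive_Re_line _ (fun w => F w * a * 1) (fun w => f w * a * 1) w 1 s
    (fun w => cderiv_mulr _ (cderiv_mulr a (dF w)))).
have lin (k s : R) : is_derive s 1 (fun t : R => k * t) k.
  by apply: is_derive_eq; rewrite /GRing.scale/= mulr1.
pose l := Re (f z * a).
have near (s t : R) : 0 <= s <= d -> 0 <= t <= d ->
    `|line (fun w => f w * a * 1 * 1) (z + s%:C) t - l| <= e / 2.
  move=> sd td; rewrite /line /l !mulr1 -raddfB/= -mulrBl.
  apply: le_trans (normr_Re_le _) _; rewrite ComplexField.Normc.normcM.
  have : normc (f (z + s%:C + t%:C) - f z) <= e / 2.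
    rewrite -addrA -rmorphD/=; apply: Hc => //; rewrite normc_real ger0_norm; rewrite /d in sd td; lra.
  by apply: le_trans; rewrite ler_piMr ?normc_ge0.
have bF (s : R) : 0 <= s <= d ->
    `|line (fun w => F w * a * 1) (z + d%:C) s - line (fun w => F w * a * 1) z s - l * d| <= e / 2 * d.
  move=> sd.
  have := @MVT_bound _ (line (fun w => F w * a * 1) (z + s%:C) \- (fun t => l * t)) _ 0 d (e / 2)
    (fun t => is_deriveB (dF' _ t) (lin l t)).
  rewrite subr0 (ger0_norm (ltW d0)) (min_idPl (ltW d0)) (max_idPr (ltW d0)) => /(_ (fun t => near s t sd)).
  rewrite /= mulr0 subr0 /line mul0r addr0 !mulr1.
  rewrite (_ : z + s%:C + d%:C = z + d%:C + s%:C); last by ring.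
  by rewrite addrAC.
have := @MVT_bound _ ((line (fun w => G w * a) (z + d%:C) \- line (fun w => G w * a) z)
    \- (fun t => l * d * t)) _ 0 d (e / 2 * d)
  (fun s => is_deriveB (is_deriveB (dG' (z + d%:C) s) (dG' z s)) (lin (l * d) s)).
rewrite subr0 (ger0_norm (ltW d0)) (min_idPl (ltW d0)) (max_idPr (ltW d0)) => /(_ bF).
rewrite /= mulr0 subr0 /line !mul0r !addr0 !mulr1 => H.
rewrite [e / 2 * d ^+ 2](_ : _ = e / 2 * d * d); last by ring.
apply: le_trans H; apply: eq_ler; congr `|_|.
rewrite /D /l -rmorphXn/= (_ : z + d%:C + d%:C = z + 2 * d%:C); last by ring.
move: (G _) (G _) (G _) (f z) a {a1 l lin near bF dF' dG'} => [? ?] [? ?] [? ?] [? ?] [? ?] /=.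
by ring.
Qed.

(** Whether [f] itself has the four-point property is not clear before
    knowing that it is twice differentiable. Second difference quotients of a
    second primitive have it, being combinations of translates, and they
    approximate [f]. *)
Lemma entire_four_point_approx f (r e : R) : entire f -> 0 < e ->
  exists g, [/\ four_point_mean g, ccontinuous g &
    forall z, normc z <= r -> normc (g z - f z) <= e].
Proof.
move=> fe e0; have [F dF] := primitive fe.
have [G dG] : exists G, forall z, cderiv G z (F z).
  by apply: primitive; apply/entireP => z; exists (f z).
have cf := entire_continuous fe.
have [d d0 Hd] := second_difference_cvg r cf dF dG e0.
have mG := four_point_second_primitive cf dF dG.
have cG := cderiv_continuous dG.
pose k := (d%:C ^+ 2)^-1.
exists (fun z => k * G (1 * z + 2 * d%:C) + (- (2 * k) * G (1 * z + d%:C) + k * G (1 * z + 0))).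
split.
- by apply: four_point_meanD; [|apply: four_point_meanD]; apply: four_point_mean_affine.
- by apply: ccontinuousD; [|apply: ccontinuousD]; apply: ccontinuous_affine.
- move=> z /Hd; rewrite -/k !mul1r addr0; apply: le_trans; apply: eq_ler; congr normc.
  by ring.
Qed.

End four_point.

(** * Maximum principle and limits of entire functions *)

Section maximum_principle.
Context (R : realType).
Local Notation C := R[i].
Local Notation normc := (@ComplexField.Normc.normc R).
Local Notation Re := complex.Re.
Local Notation Im := complex.Im.
Local Notation normcM := ComplexField.Normc.normcM.
Local Notation D f z := (derivable (f : C^o -> C^o) z (1 : C^o)).
Implicit Types (f g : C -> C) (z w h d : C).

(** The function is bounded by compactness; if the supremum were not attained,
    compactness would also keep the function away from it. *)
Lemma disc_EVT (v : C -> R) (r : R) : 0 <= r ->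
  (forall z (e : R), 0 < e -> exists2 c : R, 0 < c & forall h, normc h < c ->
    `|v (z + h) - v z| <= e) ->
  exists2 z, normc z <= r & forall w, normc w <= r -> v w <= v z.
Proof.
move=> r0 cv.
have [M HM] : exists M : R, forall z, normc z <= r -> v z <= M.
  apply: (@disc_induction _ (fun A => exists M : R, forall z, A z -> v z <= M)).
  - move=> A B [a HA] [b HB]; exists (Num.max a b).
    by move=> z [/HA|/HB]; rewrite le_max => ->; rewrite ?orbT.
  - by move=> A B AB [b HB]; exists b => // z /AB; exact: HB.
  move=> z; have [c c0 Hc] := cv z _ ltr01; exists c => //.
  by exists (1 + v z) => w /Hc; rewrite subrKC ler_norml; lra.
pose E := v @` [set z | normc z <= r].
have E0 : E !=set0 by exists (v 0), 0 => //; rewrite /= expr0n/= addr0 sqrtr0.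
have Eub : has_ubound E by exists M => _ [z zr <-]; exact: HM.
have vsup z : normc z <= r -> v z <= sup E by move=> zr; apply: ub_le_sup => //; exists z.
apply: contrapT => nmax.
have lt_sup z : normc z <= r -> v z < sup E.
  move=> zr; rewrite lt_neqAle vsup// andbT; apply/eqP => vz.
  by apply: nmax; exists z => // w /vsup; rewrite vz.
have [d d0 Hd] : exists2 d : R, 0 < d & forall z, normc z <= r -> normc z <= r -> v z <= sup E - d.
  apply: (@disc_induction _ (fun A => exists2 d : R, 0 < d &
      forall z, A z -> normc z <= r -> v z <= sup E - d)).
  - move=> A B [a a0 HA] [b b0 HB]; exists (Num.min a b); first by rewrite lt_min a0.
    by move=> z [Az|Bz] zr; [have := HA z Az zr|have := HB z Bz zr];
      have : Num.min a b <= a by [rewrite ge_min lexx];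
      have : Num.min a b <= b by [rewrite ge_min lexx orbT]; lra.
  - by move=> A B AB [b b0 HB]; exists b => // z /AB; exact: HB.
  move=> z; have [zr|zr] := leP (normc z) r.
    have d0 : 0 < (sup E - v z) / 2 by have := lt_sup z zr; lra.
    have [c c0 Hc] := cv z _ d0; exists c => //; exists ((sup E - v z) / 2) => //.
    by move=> w /Hc; rewrite subrKC ler_norml; lra.
  exists (normc z - r); first lra.
  exists 1 => // w wz wr; exfalso.
  have := normc_triangle z w 0; rewrite !subr0 (normcB z); lra.
have : sup E <= sup E - d by apply: ge_sup => // _ [z zr <-]; exact: Hd.
lra.
Qed.

(** Common generalization of the integral mean of order [p] over the circle of
    radius [r] and of the modulus at a point of that circle. The last clause
    makes it depend on the values on the circle only, and continuous for uniform
    convergence there. *)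
Record circle_seminorm (r : R) (S : (C -> C) -> R) : Prop := {
  seminormD : forall f g, ccontinuous f -> ccontinuous g ->
    S (fun z => f z + g z) <= S f + S g;
  seminormZ : forall (k : C) f, ccontinuous f -> S (fun z => k * f z) <= normc k * S f;
  seminorm_bound : forall f (M : R), ccontinuous f -> 0 <= M ->
    (forall z, normc z = r -> normc (f z) <= M) -> S f <= M }.

Lemma ccontinuous_dilation f (a : C) : ccontinuous f -> ccontinuous (fun w => f (a * w)).
Proof.
move=> cf; have := ccontinuous_affine a 0 1 cf.
by rewrite (_ : (fun z => _) = fun w => f (a * w))//; apply/funext => w; rewrite mul1r addr0.
Qed.

Lemma ccontinuousZ f (k : C) : ccontinuous f -> ccontinuous (fun w => k * f w).
Proof.
move=> cf; have := ccontinuous_affine 1 0 k cf.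
by rewrite (_ : (fun z => _) = fun w => k * f w)//; apply/funext => w; rewrite mul1r addr0.
Qed.

Lemma ccontinuousB f g : ccontinuous f -> ccontinuous g -> ccontinuous (fun w => f w - g w).
Proof.
move=> cf cg; have := ccontinuousD cf (ccontinuousZ (-1) cg).
by rewrite (_ : (fun z => _) = fun w => f w - g w)//; apply/funext => w; rewrite mulN1r.
Qed.

Section seminorm.
Variables (r : R) (S : (C -> C) -> R).
Hypothesis r0 : 0 <= r.
Hypothesis S_seminorm : circle_seminorm r S.

Lemma seminorm_near f g (e : R) : ccontinuous f -> ccontinuous g -> 0 <= e ->
  (forall z, normc z = r -> normc (f z - g z) <= e) -> S f <= S g + e.
Proof.
move=> cf cg e0 fg; have cd := ccontinuousB cf cg.
have -> : f = fun z => g z + (f z - g z) by apply/funext => z; rewrite subrKC.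
apply: le_trans (seminormD S_seminorm cg cd) _.
by rewrite lerD2l; apply: (seminorm_bound S_seminorm).
Qed.

Lemma seminorm_dilation_continuous g z (e : R) : ccontinuous g -> 0 < e ->
  exists2 c : R, 0 < c & forall h, normc h < c ->
    `|S (fun w => g ((z + h) * w)) - S (fun w => g (z * w))| <= e.
Proof.
move=> cg e0; have [c c0 Hc] := ccontinuous_unif (normc z * r) cg e0.
have r1 : 0 < 1 + r by have := r0; lra.
exists (c / (1 + r)) => [|h]; first by rewrite divr_gt0.
rewrite ltr_pdivlMr//.
move=> hc; have near w : normc w = r -> normc (g ((z + h) * w) - g (z * w)) <= e.
  move=> wr; rewrite mulrDl; apply: Hc; first by rewrite normcM wr.
  by rewrite normcM wr; apply: le_lt_trans hc; rewrite ler_wpM2l ?normc_ge0//; lra.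
have c1 := @ccontinuous_dilation g (z + h) cg; have c2 := @ccontinuous_dilation g z cg.
rewrite ler_norml lerBlDl lerBrDl.
have H1 := seminorm_near c1 c2 (ltW e0) near.
have : S (fun w => g (z * w)) <= S (fun w => g ((z + h) * w)) + e.
  by apply: seminorm_near => //; [exact: ltW|move=> w /near; rewrite normcB].
lra.
Qed.

(** Were a maximum of [v z = S (g (z .)) + e |z|^2] attained at [z0] inside the disc,
    subadditivity and the four-point property would give
    [4 v z0 <= (sum of the four values of v around z0) + e x^2 - 4 e x^2] for small
    [x = |h|], as [|z|^2] gains exactly [4 x^2] on such a sum: impossible. *)
Lemma four_point_maximum g (M : R) : four_point_mean g -> ccontinuous g ->
  (forall u, normc u = 1 -> S (fun w => g (u * w)) <= M) ->
  forall z, normc z <= 1 -> S (fun w => g (z * w)) <= M.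
Proof.
move=> mg cg gM z z1; apply/ler_addgt0Pr => e e0.
pose v (z : C) := S (fun w => g (z * w)) + e * normc z ^+ 2.
have sqc (u : C) : normc u ^+ 2 = Re u ^+ 2 + Im u ^+ 2.
  by case: u => a b; rewrite sqr_sqrtr// addr_ge0// sqr_ge0.
have cv u (e' : R) : 0 < e' -> exists2 c : R, 0 < c & forall h, normc h < c ->
    `|v (u + h) - v u| <= e'.
  move=> e'0; have e2 : 0 < e' / 2 by lra.
  have [c c0 Hc] := seminorm_dilation_continuous u cg e2.
  have k0 : 0 < e * (2 * normc u + 1).
    by rewrite mulr_gt0//; have := normc_ge0 u; lra.
  exists (Num.min (Num.min c 1) (e' / 2 / (e * (2 * normc u + 1)))) => [|h].
    by rewrite !lt_min c0 ltr01 divr_gt0.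
  rewrite !lt_min ltr_pdivlMr// => /andP[/andP[/Hc{}Hc h1] hk].
  have : `|e * normc (u + h) ^+ 2 - e * normc u ^+ 2| <= e' / 2.
    rewrite -mulrBr normrM (gtr0_norm e0) subr_sqr normrM.
    have t1 : `|normc (u + h) - normc u| <= normc h.
      rewrite ler_norml; have := le_normcD u h.
      by have := normc_triangle u (u + h) 0; rewrite !subr0 opprD addNKr normcN; lra.
    have t2 : `|normc (u + h) + normc u| <= 2 * normc u + 1.
      by have := normc_ge0 (u + h); have := normc_ge0 u; have := le_normcD u h;
        rewrite ler_norml; lra.
    apply: le_trans (ltW hk); rewrite [leRHS]mulrCA ler_pM2l//.
    by apply: ler_pM.
  by move: Hc; rewrite /v !ler_norml; lra.
have [z0 z01 zmax] := disc_EVT (r := 1) ler01 cv.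
have [zlt|zge] := ltP (normc z0) 1; last first.
  have z0E : normc z0 = 1 by apply/eqP; rewrite eq_le z01.
  have := zmax z z1; rewrite /v z0E expr1n mulr1.
  have : 0 <= e * normc z ^+ 2 by rewrite mulr_ge0 ?exprn_ge0 ?normc_ge0// ltW.
  by have := gM z0 z0E; lra.
exfalso; have rge0 := r0.
have rr : 0 < 1 + r ^+ 2 by have : 0 <= r ^+ 2 by [rewrite exprn_ge0]; lra.
have [c c0 Hc] := mg r _ (divr_gt0 e0 rr).
(* small enough for the four points to stay in the disc and for the four-point
   estimate to hold along the whole circle of radius r *)
pose x := Num.min (1 - normc z0) (c / (1 + r) / 2).
have x0 : 0 < x by rewrite lt_min subr_gt0 zlt !divr_gt0//; lra.
have x1 : normc z0 + x <= 1.
  by have : x <= 1 - normc z0 by [rewrite ge_min lexx]; lra.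
have xc : x * r < c.
  have x2 : x <= c / (1 + r) / 2 by rewrite ge_min lexx orbT.
  have r1 : 0 < 1 + r by lra.
  apply: le_lt_trans (_ : x * (1 + r) < c); first by rewrite ler_pM2l//; lra.
  apply: le_lt_trans (ler_wpM2r (ltW r1) x2) _.
  by rewrite mulrAC divfK ?gt_eqF//; lra.
pose h : C := x%:C.
have hx : normc h = x by rewrite normc_real gtr0_norm.
have ix : normc ('i * h) = x.
  by rewrite normcM hx /= expr0n expr1n add0r sqrtr1 mul1r.
have inside u : normc u = x -> normc (z0 + u) <= 1.
  by move=> ux; apply: le_trans (le_normcD _ _) _; rewrite ux.
have m1 := zmax _ (inside h hx).
have m2 := zmax (z0 - h) (inside (- h) (etrans (normcN _) hx)).
have m3 := zmax _ (inside _ ix).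
have m4 := zmax (z0 - 'i * h) (inside (- ('i * h)) (etrans (normcN _) ix)).
have sqs : normc (z0 + h) ^+ 2 + normc (z0 - h) ^+ 2 + normc (z0 + 'i * h) ^+ 2
    + normc (z0 - 'i * h) ^+ 2 = 4 * normc z0 ^+ 2 + 4 * x ^+ 2.
  by rewrite !sqc /h; case: (z0) => a b /=; ring.
pose g' (u : C) := fun w => g (u * w).
have cg' u : ccontinuous (g' u) by exact: ccontinuous_dilation.
pose G := fun w => g' (z0 + h) w + g' (z0 - h) w + g' (z0 + 'i * h) w + g' (z0 - 'i * h) w.
have cG : ccontinuous G by do 3 (apply: ccontinuousD => //).
have SG : S G <= S (g' (z0 + h)) + S (g' (z0 - h)) + S (g' (z0 + 'i * h)) + S (g' (z0 - 'i * h)).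
  have c2 := ccontinuousD (cg' (z0 + h)) (cg' (z0 - h)).
  have c3 := ccontinuousD c2 (cg' (z0 + 'i * h)).
  apply: le_trans (seminormD S_seminorm c3 (cg' (z0 - 'i * h))) _; rewrite lerD2r.
  apply: le_trans (seminormD S_seminorm c2 (cg' (z0 + 'i * h))) _; rewrite lerD2r.
  exact: (seminormD S_seminorm).
have near w : normc w = r -> normc (4%:R * g' z0 w - G w) <= e * x ^+ 2.
  move=> wr.
  have -> : 4%:R * g' z0 w - G w = - star_difference g (z0 * w) (h * w).
    by rewrite /G /g' /star_difference !mulrDl !mulNr mulrA; ring.
  rewrite normcN; apply: le_trans (Hc _ _ _ _) _; rewrite ?normcM ?hx ?wr//.
    by rewrite ler_piMl.
  have -> : e / (1 + r ^+ 2) * (x * r) ^+ 2 = e * x ^+ 2 * (r ^+ 2 / (1 + r ^+ 2)) by ring.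
  rewrite ler_piMr ?mulr_ge0 ?(ltW e0) ?exprn_ge0 ?(ltW x0)// ler_pdivrMr// mul1r; lra.
have S4 : 4 * S (g' z0) <= S G + e * x ^+ 2.
  have S4' : S (fun w => 4%:R * g' z0 w) <= S G + e * x ^+ 2.
    apply: seminorm_near => //; first exact: ccontinuousZ.
    by rewrite mulr_ge0 ?exprn_ge0// ltW.
  have := seminormZ S_seminorm (4%:R^-1) (ccontinuousZ 4%:R (cg' z0)).
  rewrite (_ : (fun w => _) = g' z0); last first.
    by apply/funext => w; rewrite mulKf// pnatr_eq0.
  have -> : normc (4%:R^-1) = 4^-1.
    rewrite ComplexField.Normc.normcV; congr _^-1.
    by rewrite -[4%:R](rmorph_nat (@real_complex R)) normc_real ger0_norm.
  lra.
have ex2 : 0 < e * x ^+ 2 by rewrite mulr_gt0// exprn_gt0.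
have := congr1 ( *%R e) sqs; rewrite !mulrDr.
move: m1 m2 m3 m4; rewrite /v -!/(g' _); lra.
Qed.

(** The four-point property is only needed for functions approximating [f] uniformly
    on the disc of radius [r]. *)
Lemma entire_maximum f (M : R) : entire f ->
  (forall u, normc u = 1 -> S (fun w => f (u * w)) <= M) ->
  forall z, normc z <= 1 -> S (fun w => f (z * w)) <= M.
Proof.
move=> fe fM z z1; apply/ler_addgt0Pr => e e0.
have e2 : 0 < e / 2 by lra.
have cf := entire_continuous fe.
have [g [mg cg gf]] := entire_four_point_approx r fe e2.
have near u w : normc u <= 1 -> normc w = r -> normc (g (u * w) - f (u * w)) <= e / 2.
  by move=> u1 wr; apply: gf; rewrite normcM wr ler_piMl.
have := @four_point_maximum g (M + e / 2) mg cg.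
have cfu u := @ccontinuous_dilation f u cf; have cgu u := @ccontinuous_dilation g u cg.
move=> /(_ _ z z1) H.
have : S (fun w => f (z * w)) <= S (fun w => g (z * w)) + e / 2.
  by apply: seminorm_near => //; [exact: ltW|move=> w wr; rewrite normcB; exact: near].
suff : S (fun w => g (z * w)) <= M + e / 2 by lra.
apply: H => u u1; have := fM u u1.
suff : S (fun w => g (u * w)) <= S (fun w => f (u * w)) + e / 2 by lra.
by apply: seminorm_near => //; [exact: ltW|move=> w wr; apply: near; rewrite ?u1].
Qed.

End seminorm.

Lemma maximum_modulus f (r M : R) : entire f -> 0 < r ->
  (forall z, normc z = r -> normc (f z) <= M) ->
  forall z, normc z <= r -> normc (f z) <= M.
Proof.
move=> fe r0 fM z zr.
have Snorm : circle_seminorm r (fun g => normc (g r%:C)).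
  split=> [g h _ _|k g _|g N _ _]; first exact: le_normcD.
    by rewrite normcM.
  by apply; rewrite normc_real gtr0_norm.
have rC : r%:C != 0 :> C by rewrite -(rmorph0 (@real_complex R)) (inj_eq (@complexI R)) gt_eqF.
have nr : normc r%:C = r by rewrite normc_real gtr0_norm.
have := entire_maximum (ltW r0) Snorm fe (M := M) _ (z := z / r%:C).
rewrite divfK//; apply; first by move=> u u1; apply: fM; rewrite normcM u1 mul1r.
by rewrite normcM ComplexField.Normc.normcV nr ler_pdivrMr// mul1r.
Qed.

Lemma derivable_cderiv f z : D f z <-> exists d, cderiv f z d.
Proof.
by split=> [/cvg_ex[d /cderivP]|[d /cderivP fd]]; [exists d|apply/cvg_ex; exists d].
Qed.

Lemma cderiv_shift f z a d : cderiv f (a + z) d -> cderiv (fun w => f (a + w)) z d.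
Proof.
by move=> fd e /fd[c c0 Hc]; exists c => // h /Hc; rewrite addrA.
Qed.

Lemma normcX z n : normc (z ^+ n) = normc z ^+ n.
Proof. by elim: n => [|n IH]; rewrite ?ComplexField.Normc.normc1// !exprS normcM IH. Qed.

(** Cauchy's inequality without Cauchy's formula. The difference quotient [q] at [z]
    is bounded by [2 M] on the unit circle; the maximum modulus principle applied to
    [k^2 q(k)^n] gives [|h|^2 |q(h)|^n <= (2 M)^n], and letting [n] tend to infinity
    removes the factor [|h|^2]. *)
Lemma entire_lipschitz f z (M : R) : entire f ->
  (forall h, normc h <= 1 -> normc (f (z + h)) <= M) ->
  forall h, normc h <= 1 -> normc (f (z + h) - f z) <= 2 * M * normc h.
Proof.
move=> fe fM h h1; have [->|h0] := eqVneq h 0.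
  by rewrite addr0 subrr ComplexField.Normc.normc0 mulr0.
have hp : 0 < normc h by rewrite lt_neqAle normc_ge0 eq_sym normc_eq0 h0.
pose q (k : C) := (f (z + k) - f z) * k^-1.
have qM (k : C) : normc k = 1 -> normc (q k) <= 2 * M.
  move=> k1; rewrite normcM ComplexField.Normc.normcV k1 invr1 mulr1.
  apply: le_trans (le_normcD _ _) _; rewrite normcN.
  have := fM k ltac:(by rewrite k1); have := fM 0; rewrite ComplexField.Normc.normc0 addr0 => /(_ ler01).
  lra.
have M0 : 0 <= 2 * M.
  by apply: le_trans (qM 1 _); [exact: normc_ge0|exact: ComplexField.Normc.normc1].
(* the squared factor makes the product vanish to second order at the removable singularity *)
have pe n : entire (fun k : C => k ^+ 2 * q k ^+ n).
  move=> k; have [->{k}|k0] := eqVneq k 0.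
    have [d fd] := (entireP f).1 fe z.
    have [c c0 Hc] := fd 1 ltr01.
    apply/derivable_cderiv; exists 0 => e e0.
    pose K := (1 + normc d) ^+ n.
    have K0 : 0 < K by rewrite exprn_gt0//; have := normc_ge0 d; lra.
    exists (Num.min c (e / K)); first by rewrite lt_min c0 divr_gt0.
    move=> k; rewrite lt_min ltr_pdivlMr// => /andP[/Hc{}Hc kK].
    have [->|k0] := eqVneq k 0.
      by rewrite addr0 subrr mulr0 subr0 ComplexField.Normc.normc0 mulr0.
    have kp : 0 < normc k by rewrite lt_neqAle normc_ge0 eq_sym normc_eq0 k0.
    have qk : normc (q k) <= 1 + normc d.
      rewrite normcM ComplexField.Normc.normcV ler_pdivrMr// mulrDl -normcM.
      rewrite -[X in normc X](subrK (d * k)); apply: le_trans (le_normcD _ _) _.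
      by rewrite lerD2r.
    rewrite add0r expr0n mul0r subr0 mul0r subr0 normcM !normcX expr2.
    rewrite mulrAC ler_pM2r// mulrC.
    apply: le_trans (ltW kK); rewrite mulrC ler_pM2l// /K.
    by apply: lerXn2r; rewrite ?nnegrE ?normc_ge0//; have := normc_ge0 d; lra.
  have df : D (fun k => f (z + k)) k.
    have [d /cderiv_shift fd] := (entireP f).1 fe (z + k).
    by apply/derivable_cderiv; exists d.
  have did : D id k := @derivable_id _ _ _ _.
  have dg : D (fun k => f (z + k) - f z) k := derivableB df (@derivable_cst _ _ _ _ _ _).
  have dV : D (fun k => k^-1) k := derivableV k0 did.
  have dM : D (fun k => (f (z + k) - f z) / k) k := derivableM dg dV.
  have dX : D (fun k => ((f (z + k) - f z) / k) ^+ n) k.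
    by have := derivableX (n := n) dM; rewrite exprfctE.
  have d2 : D (fun k => k ^+ 2) k.
    by have := derivableX (n := 2) did; rewrite exprfctE.
  exact: (derivableM d2 dX).
have bound n : normc h ^+ 2 * normc (q h) ^+ n <= (2 * M) ^+ n.
  rewrite -!normcX -normcM.
  apply: (maximum_modulus (pe n) ltr01) h1 => k k1.
  rewrite normcM !normcX k1 expr1n mul1r.
  by apply: lerXn2r; rewrite ?nnegrE ?normc_ge0//; exact: qM.
suff qh : normc (q h) <= 2 * M.
  by rewrite -ler_pdivrMr// -ComplexField.Normc.normcV -normcM.
rewrite leNgt; apply/negP => Mq.
have q0 : 0 < normc (q h) by lra.
pose t := 2 * M / normc (q h).
have t1 : `|t| < 1.
  by rewrite ger0_norm ?divr_ge0 ?(ltW q0)// ltr_pdivrMr// mul1r.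
have h2 : 0 < normc h ^+ 2 by rewrite exprn_gt0.
have /cvgrPdist_lt/(_ _ h2)[n _ /(_ n (leqnn n))] := cvg_expr t1.
rewrite /= sub0r normrN ger0_norm ?exprn_ge0 ?divr_ge0 ?(ltW q0)//.
rewrite /t expr_div_n ltr_pdivrMr ?exprn_gt0//.
by have := bound n; lra.
Qed.

(** Differences of approximants are uniformly small, hence so are their difference
    quotients by [entire_lipschitz]: the derivatives of the approximants converge,
    and the limit is the derivative of [f]. *)
Lemma entire_of_approx f :
  (forall r e : R, 0 < e -> exists2 g, entire g &
    forall z, normc z <= r -> normc (g z - f z) <= e) -> entire f.
Proof.
move=> fapp; apply/entireP => z.
have Hg0 (e : R) : exists g : C -> C, 0 < e -> entire g /\
    forall w, normc w <= normc z + 1 -> normc (g w - f w) <= e.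
  have [e0|] := ltP 0 e; last by exists f; lra.
  by have [g ge gf] := fapp (normc z + 1) e e0; exists g.
have [g Hg] := choice Hg0.
have Hd0 (e : R) : exists d : C, 0 < e -> cderiv (g e) z d.
  have [e0|] := ltP 0 e; last by exists 0; lra.
  by have [/entireP/(_ z)[d gd] _] := Hg e e0; exists d.
have [d Hd] := choice Hd0.
have inside (h : C) : normc h <= 1 -> normc (z + h) <= normc z + 1.
  by move=> h1; apply: le_trans (le_normcD _ _) _; rewrite lerD2l.
have lip (a b : R) (h : C) : 0 < a -> 0 < b -> normc h <= 1 ->
    normc (g a (z + h) - g a z - (g b (z + h) - g b z)) <= 2 * (a + b) * normc h.
  move=> a0 b0 h1; have [ge ga] := Hg a a0; have [ge' gb] := Hg b b0.
  have de : entire (fun w => g a w - g b w).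
    by move=> w; apply: derivableB; [exact: ge|exact: ge'].
  have := entire_lipschitz (z := z) (M := a + b) de _ h1.
  rewrite (_ : g a (z + h) - g b (z + h) - (g a z - g b z) =
    g a (z + h) - g a z - (g b (z + h) - g b z)); last by ring.
  apply=> k /inside kz; apply: le_trans (normc_triangle _ (f (z + k)) _) _.
  by rewrite (normcB (f _)); apply: lerD; [exact: ga|exact: gb].
have gf (a : R) (h : C) : 0 < a -> normc h <= 1 ->
    normc (f (z + h) - f z - (g a (z + h) - g a z)) <= 2 * a * normc h.
  move=> a0 h1; apply/ler_addgt0Pr => e e0.
  have [b b0 be] : exists2 b : R, 0 < b & e = 4 * b by exists (e / 4); lra.
  have [_ gb] := Hg b b0; have H1 := gb _ (inside h h1).
  have H2 := gb z ltac:(lra); have H3 := lip b a h b0 a0 h1.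
  have -> : f (z + h) - f z - (g a (z + h) - g a z) =
      (g b (z + h) - g b z - (g a (z + h) - g a z)) +
      ((g b z - f z) - (g b (z + h) - f (z + h))) by ring.
  apply: le_trans (le_normcD _ _) _.
  have := le_normcD (g b z - f z) (- (g b (z + h) - f (z + h))); rewrite normcN.
  have : 2 * (b + a) * normc h <= 2 * a * normc h + 2 * b.
    by rewrite mulrDr mulrDl addrC lerD2l ler_piMr//; lra.
  by lra.
have dd (a b : R) : 0 < a -> 0 < b -> normc (d a - d b) <= 2 * (a + b).
  move=> a0 b0; apply/ler_addgt0Pr => e e0; have e2 : 0 < e / 2 by lra.
  have [c c0 Hc] := Hd a a0 _ e2; have [c' c'0 Hc'] := Hd b b0 _ e2.
  pose x := Num.min (Num.min c c' / 2) 1.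
  have x0 : 0 < x by rewrite lt_min ltr01 andbT divr_gt0// lt_min c0.
  have mm : Num.min c c' <= c /\ Num.min c c' <= c' by rewrite !ge_min !lexx orbT.
  have mp : 0 < Num.min c c' by rewrite lt_min c0.
  have xm : x <= Num.min c c' / 2 by rewrite ge_min lexx.
  have nx : normc x%:C = x by rewrite normc_real gtr0_norm.
  have H1 := Hc x%:C ltac:(rewrite nx; lra).
  have H2 := Hc' x%:C ltac:(rewrite nx; lra).
  have H3 := lip a b x%:C a0 b0 ltac:(by rewrite nx ge_min lexx orbT).
  rewrite -(ler_pM2r x0) -{1}nx -normcM.
  have -> : (d a - d b) * x%:C = (g a (z + x%:C) - g a z - (g b (z + x%:C) - g b z))
    - (g a (z + x%:C) - g a z - d a * x%:C) + (g b (z + x%:C) - g b z - d b * x%:C) by ring.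
  apply: le_trans (le_normcD _ _) _.
  have := le_normcD (g a (z + x%:C) - g a z - (g b (z + x%:C) - g b z))
    (- (g a (z + x%:C) - g a z - d a * x%:C)).
  by rewrite normcN; rewrite nx in H1 H2 H3; rewrite mulrDl; lra.
(* a complete limit of the derivatives, squeezed coordinatewise *)
have lim (u : R -> R) : (forall a b : R, 0 < a -> 0 < b -> `|u a - u b| <= 2 * (a + b)) ->
    exists l, forall a : R, 0 < a -> `|u a - l| <= 2 * a.
  move=> Hu; pose E := [set u a - 2 * a | a in [set a : R | 0 < a]].
  have ub (b : R) : 0 < b -> ubound E (u b + 2 * b).
    by move=> b0 _ [a a0 <-]; have := Hu a b a0 b0; rewrite ler_norml; lra.
  exists (sup E) => a a0; rewrite ler_norml.
  have : sup E <= u a + 2 * a by apply: ge_sup (ub a a0); exists (u 1 - 2 * 1), 1 => /=.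
  have : u a - 2 * a <= sup E by apply: ub_le_sup; [exists (u 1 + 2 * 1); exact: ub|exists a].
  lra.
have [x Hx] := lim (fun a => Re (d a)) (fun a b a0 b0 =>
  le_trans (le_trans (eq_ler (congr1 Num.norm (esym (raddfB _ (d a) (d b)))))
    (normr_Re_le _)) (dd a b a0 b0)).
have [y Hy] := lim (fun a => Im (d a)) (fun a b a0 b0 =>
  le_trans (le_trans (eq_ler (congr1 Num.norm (esym (raddfB _ (d a) (d b)))))
    (normr_Im_le _)) (dd a b a0 b0)).
(* the three error terms below add up to (2 + 1 + 4) a |h| *)
exists (x +i* y) => e e0; pose a := e / 12.
have a0 : 0 < a by rewrite /a; lra.
have [c c0 Hc] := Hd a a0 a a0.
exists (Num.min c 1) => [|h]; first by rewrite lt_min c0 ltr01.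
rewrite lt_min => /andP[/Hc{}Hc /ltW h1].
have dl : normc (d a - (x +i* y)) <= 4 * a.
  apply: le_trans (normc_le_ReIm _) _; have := Hx a a0; have := Hy a a0.
  by case: (d a) => [? ?] /=; lra.
have -> : f (z + h) - f z - (x +i* y) * h = (f (z + h) - f z - (g a (z + h) - g a z))
  + ((g a (z + h) - g a z - d a * h) + (d a - (x +i* y)) * h) by ring.
apply: le_trans (le_normcD _ _) _.
have := le_normcD (g a (z + h) - g a z - d a * h) ((d a - (x +i* y)) * h).
rewrite normcM; have := gf a h a0 h1.
have := ler_wpM2r (normc_ge0 h) dl.
have -> : e = 12 * a by rewrite /a; field.
have : 0 <= a * normc h by rewrite mulr_ge0 ?normc_ge0// ltW.
lra.
Qed.

End maximum_principle.

(** * Integral means over circles *)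

Section curves.
Context (R : realType).
Local Notation C := R[i].
Local Notation normc := (@ComplexField.Normc.normc R).
Local Notation Re := complex.Re.
Local Notation Im := complex.Im.
Implicit Types (f g : C -> C) (a b : R -> R).

(** Integrands are only known through continuous parametrizations of the two real
    coordinates: circles here, and the curves [t |-> z/t] for the Hausdorff
    operator. *)
Lemma ccontinuous_curve f a b (x e : R) : ccontinuous f ->
  {for x, continuous a} -> {for x, continuous b} -> 0 < e ->
  \forall y \near x, normc (f (a x +i* b x) - f (a y +i* b y)) <= e.
Proof.
move=> cf ca cb e0; have [c c0 Hc] := cf (a x +i* b x) e e0.
have c2 : 0 < c / 2 by lra.
near=> y.
have ay : `|a x - a y| < c / 2 by near: y; move/cvgrPdist_lt: ca; exact.
have bY : `|b x - b y| < c / 2 by near: y; move/cvgrPdist_lt: cb; exact.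
have := Hc ((a y - a x) +i* (b y - b x)).
have -> : (a x +i* b x) + ((a y - a x) +i* (b y - b x)) = a y +i* b y.
  by apply/eqP; rewrite eq_complex/= !subrKC !eqxx.
rewrite normcB; apply; apply: le_lt_trans (normc_le_ReIm _) _ => /=.
by rewrite distrC (distrC (b y)); lra.
Unshelve. all: by end_near. Qed.

Lemma normc_dist (z w : C) : `|normc z - normc w| <= normc (z - w).
Proof.
have := normc_triangle z w 0; have := normc_triangle w z 0.
by rewrite !subr0 (normcB w) ler_norml; lra.
Qed.

Lemma continuous_normc_curve f a b (x : R) : ccontinuous f ->
  {for x, continuous a} -> {for x, continuous b} ->
  {for x, continuous (fun y => normc (f (a y +i* b y)))}.
Proof.
move=> cf ca cb; apply/cvgrPdist_le => e e0.
near=> y; apply: le_trans (normc_dist _ _) _.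
by near: y; exact: ccontinuous_curve.
Unshelve. all: by end_near. Qed.

Lemma continuous_Re_curve f a b (x : R) : ccontinuous f ->
  {for x, continuous a} -> {for x, continuous b} ->
  {for x, continuous (fun y => Re (f (a y +i* b y)))}.
Proof.
move=> cf ca cb; apply/cvgrPdist_le => e e0.
near=> y; rewrite -raddfB; apply: le_trans (normr_Re_le _) _.
by near: y; exact: ccontinuous_curve.
Unshelve. all: by end_near. Qed.

Lemma continuous_Im_curve f a b (x : R) : ccontinuous f ->
  {for x, continuous a} -> {for x, continuous b} ->
  {for x, continuous (fun y => Im (f (a y +i* b y)))}.
Proof.
move=> cf ca cb; apply/cvgrPdist_le => e e0.
near=> y; rewrite -raddfB; apply: le_trans (normr_Im_le _) _.
by near: y; exact: ccontinuous_curve.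
Unshelve. all: by end_near. Qed.

End curves.

Section integral_means.
Context (R : realType).
Local Notation C := R[i].
Local Notation leb := (@lebesgue_measure R).
Local Notation normc := (@ComplexField.Normc.normc R).
Local Notation Re := complex.Re.
Local Notation Im := complex.Im.
Local Notation normcM := ComplexField.Normc.normcM.
Implicit Types (f g : C -> C) (p : \bar R) (r : R).

Definition circle_point r (x : R) : C := r * cos x +i* (r * sin x).

Lemma normc_circle_point r x : 0 <= r -> normc (circle_point r x) = r.
Proof.
move=> r0; rewrite /circle_point /= !exprMn -mulrDr cos2Dsin2 mulr1.
by rewrite sqrtr_sqr ger0_norm.
Qed.

Lemma polar_form (u : C) : normc u = 1 -> exists a : R, u = circle_point 1 a.
Proof.
case: u => x y /= xy; have {}xy : x ^+ 2 + y ^+ 2 = 1.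
  by rewrite -[LHS]sqr_sqrtr ?xy ?expr1n// addr_ge0 ?sqr_ge0.
have x1 : -1 <= x <= 1.
  by rewrite -ler_norml -(ler_pXn2r (n := 2)) ?nnegrE// expr1n real_normK ?num_real//;
    have := sqr_ge0 y; lra.
have y2 : 1 - x ^+ 2 = y ^+ 2 by rewrite -xy; ring.
have [y0|/ltW y0] := leP 0 y.
  exists (acos x); rewrite /circle_point !mul1r acosK ?in_itv// sin_acos//.
  by rewrite y2 sqrtr_sqr ger0_norm.
exists (- acos x); rewrite /circle_point !mul1r cosN sinN acosK ?in_itv// sin_acos//.
by rewrite y2 sqrtr_sqr ler0_norm// opprK.
Qed.

Lemma circle_point_rot (a x r : R) :
  circle_point 1 a * circle_point r x = circle_point r (x + a).
Proof.
by rewrite /circle_point cosD sinD; apply/eqP; rewrite eq_complex/=; apply/andP; split; apply/eqP; ring.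
Qed.

Lemma continuous_circle_modulus f r :
  ccontinuous f -> continuous (fun x => normc (f (circle_point r x))).
Proof.
move=> cf x; apply: continuous_normc_curve => //.
  by apply: cvgMr; exact: continuous_cos.
by apply: cvgMr; exact: continuous_sin.
Qed.

Lemma continuous_powR_ge1 (p : R) : 1 <= p -> continuous (fun t : R => `|t| `^ p).
Proof.
move=> p1 t; have [->|t0] := eqVneq t 0.
  (* at 0 the power is dominated by the identity, as the exponent is at least 1 *)
  apply/cvgrPdist_le => e e0; rewrite normr0 powR0; last by rewrite gt_eqF//; lra.
  apply/nbhs_ballP; exists (Num.min e 1); first by rewrite /= lt_min e0 ltr01.
  move=> s; rewrite /ball/= !sub0r !normrN lt_min => /andP[se s1].
  rewrite ger0_norm ?powR_ge0//; apply: le_trans (ltW se).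
  have [->|s0] := eqVneq s 0; first by rewrite normr0 powR0//; rewrite gt_eqF//; lra.
  by apply: ge1r_powR => //; rewrite normr_gt0 s0 ltW.
have dp : derivable (@powR R ^~ p) `|t| 1.
  by apply: derivable_powR; rewrite in_itv/= normr_gt0 t0.
have cp : {for `|t|, continuous (@powR R ^~ p)}.
  by apply: differentiable_continuous; apply/derivable1_diffP.
exact: (continuous_comp (@norm_continuous _ _ t) cp).
Qed.

Section finite_exponent.
Variables (p r : R).
Hypothesis p1 : 1 <= p.
Local Notation D := (`[0%R, (2 * pi)%R]%classic : set R).
Local Notation k f := (fun x : R => normc (f (circle_point r x))).

Let p0 : 0 < p. Proof. by apply: lt_le_trans p1. Qed.
Let pi2 : 0 < 2 * pi :> R. Proof. by rewrite mulr_gt0 ?pi_gt0. Qed.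

Lemma integral_mean_finE f : integral_mean p%:E f r =
  ((((2 * pi)^-1)%:E * \int[leb]_(x in D) (k f x `^ p)%:E) `^ p^-1)%E.
Proof. by []. Qed.

Lemma continuous_circle_powR f : ccontinuous f -> continuous (fun x => k f x `^ p).
Proof.
move=> cf x.
have := continuous_comp (@continuous_circle_modulus f r cf x) (@continuous_powR_ge1 p p1 _).
by rewrite (_ : _ \o _ = fun x => k f x `^ p)//; apply/funext => y /=; rewrite ger0_norm// normc_ge0.
Qed.

Lemma measurable_circle_powR f : ccontinuous f ->
  measurable_fun D (fun x => k f x `^ p).
Proof.
move=> cf; apply: measurable_funTS.
exact: continuous_measurable_fun (continuous_circle_powR cf).
Qed.

Lemma le_integral_mean_fin f g : ccontinuous f -> ccontinuous g ->
  (forall x, k f x <= k g x) -> (integral_mean p%:E f r <= integral_mean p%:E g r)%E.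
Proof.
move=> cf cg fg; rewrite !integral_mean_finE.
have c0 : (0 <= ((2 * pi)^-1)%:E :> \bar R)%E by rewrite lee_fin invr_ge0 ltW.
have I0 h : (0 <= \int[leb]_(x in D) (k h x `^ p)%:E)%E.
  by apply: integral_ge0 => x _; rewrite lee_fin powR_ge0.
apply: gt0_ler_poweR; rewrite ?in_itv/= ?leey ?andbT ?mule_ge0 ?invr_ge0 ?(ltW p0)//.
apply: lee_wpmul2l => //; apply: ge0_le_integral => //.
- by move=> x _; rewrite lee_fin powR_ge0.
- by apply/measurable_EFinP; exact: measurable_circle_powR.
- by apply/measurable_EFinP; exact: measurable_circle_powR.
- by move=> x _; rewrite lee_fin ge0_ler_powR ?nnegrE ?normc_ge0// ltW.
Qed.

Lemma integral_mean_cst_fin (c : C) : integral_mean p%:E (fun=> c) r = (normc c)%:E.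
Proof.
rewrite integral_mean_finE integral_cst//= lebesgue_measure_itv/= lte_fin pi2 -EFinB subr0.
rewrite -!EFinM mulrCA mulVf ?gt_eqF// mulr1 poweR_EFin -powRrM mulfV ?gt_eqF//.
by rewrite powRr1// normc_ge0.
Qed.

Lemma integral_meanZ_fin (c : C) f : ccontinuous f ->
  (integral_mean p%:E (fun z => c * f z)%R r = (normc c)%:E * integral_mean p%:E f r)%E.
Proof.
move=> cf; rewrite !integral_mean_finE.
have c0 : (0 <= ((2 * pi)^-1)%:E :> \bar R)%E by rewrite lee_fin invr_ge0 ltW.
have I0 : (0 <= \int[leb]_(x in D) (k f x `^ p)%:E)%E.
  by apply: integral_ge0 => x _; rewrite lee_fin powR_ge0.
have -> : (\int[leb]_(x in D) (normc (c * f (circle_point r x)) `^ p)%:E =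
    (normc c `^ p)%:E * \int[leb]_(x in D) (k f x `^ p)%:E)%E.
  under eq_integral do rewrite normcM powRM ?normc_ge0// EFinM.
  rewrite ge0_integralZl_EFin ?powR_ge0//.
    by move=> x _; rewrite lee_fin powR_ge0.
  by apply/measurable_EFinP; exact: measurable_circle_powR.
rewrite muleCA (@poweRM _ (normc c `^ p)%:E) ?lee_fin ?powR_ge0 ?mule_ge0//.
by rewrite poweR_EFin -powRrM mulfV ?gt_eqF// powRr1// normc_ge0.
Qed.

(** Identifies the mean with an [L^p] norm, so that Minkowski's inequality applies. *)
Lemma integral_mean_LnormE f : integral_mean p%:E f r =
  ((((2 * pi)^-1) `^ p^-1)%:E * Lnorm leb p%:E (EFin \o (k f \_ D)))%E.
Proof.
have c0 : (0 <= ((2 * pi)^-1)%:E :> \bar R)%E by rewrite lee_fin invr_ge0 ltW.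
rewrite integral_mean_finE poweRM//; last first.
  by apply: integral_ge0 => x _; rewrite lee_fin powR_ge0.
have E : (\int[leb]_x (`|(EFin \o (k f \_ D)) x| `^ p) =
    \int[leb]_(x in D) (k f x `^ p)%:E)%E.
  rewrite [RHS]integral_mkcond; apply: eq_integral => x _ /=.
  rewrite patchE [in RHS]patchE; case: ifP => _ /=.
    by rewrite ger0_norm ?normc_ge0.
  by rewrite normr0 powR0// gt_eqF.
by rewrite unlock E poweR_EFin.
Qed.

Lemma integral_meanD_fin f g : ccontinuous f -> ccontinuous g ->
  (integral_mean p%:E (fun z => f z + g z)%R r <=
   integral_mean p%:E f r + integral_mean p%:E g r)%E.
Proof.
move=> cf cg.
have mk h : ccontinuous h -> measurable_fun setT (k h \_ D).
  move=> ch; apply/(measurable_restrictT _ _).1 => //; apply: measurable_funTS.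
  exact: continuous_measurable_fun (continuous_circle_modulus ch).
have mp (h : R -> R) : measurable_fun setT h ->
    measurable_fun setT (fun x => `|(EFin \o h) x| `^ p)%E.
  move=> mh; apply: (measurableT_comp (@measurable_poweR _ _)).
  by apply: measurableT_comp => //; exact/measurable_EFinP.
have mink := @minkowski_EFin _ _ _ leb _ _ _ (mk f cf) (mk g cg) p1.
rewrite !integral_mean_LnormE -ge0_muleDr ?Lnorm_ge0//.
rewrite lee_wpmul2l ?lee_fin ?powR_ge0//; apply: le_trans mink.
rewrite unlock /Lnorm; apply: gt0_ler_poweR.
- by rewrite invr_ge0 ltW.
- by rewrite in_itv/= leey andbT integral_ge0// => x _; exact: poweR_ge0.
- by rewrite in_itv/= leey andbT integral_ge0// => x _; exact: poweR_ge0.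
apply: ge0_le_integral => //.
- by move=> x _; exact: poweR_ge0.
- exact: (mp _ (mk _ (ccontinuousD cf cg))).
- exact: (mp _ (measurable_funD (mk f cf) (mk g cg))).
- move=> x _ /=; rewrite lee_fin ge0_ler_powR ?nnegrE ?(ltW p0)//=.
  rewrite !patchE; case: ifP => _; last by rewrite addr0.
  by rewrite !ger0_norm ?addr_ge0 ?normc_ge0// le_normcD.
Qed.

Lemma is_derive_translate (K : R -> R) (x b d : R) :
  is_derive (x + b) 1 K d -> is_derive x 1 (fun y => K (y + b)) d.
Proof.
move=> /is_derive_eps H; apply/is_derive_eps => e /H[c c0 Hc]; exists c => // h /Hc.
by rewrite (addrAC x h b).
Qed.

(** The primitive [K] of the [2 pi]-periodic integrand satisfies
    [K (2 pi + b) - K b = constant], since the derivative in [b] vanishes. *)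
Lemma circle_integral_shift f (a : R) : ccontinuous f ->
  (\int[leb]_(x in D) (k f (x + a) `^ p)%:E = \int[leb]_(x in D) (k f x `^ p)%:E)%E.
Proof.
move=> cf.
have ck := continuous_circle_powR cf.
have [K dK] := antiderivative ck.
have FTC (b : R) : (\int[leb]_(x in D) (k f (x + b) `^ p)%:E = (K (2 * pi + b) - K b)%:E)%E.
  have dKb (x : R) : is_derive x 1 (fun y => K (y + b)) (k f (x + b) `^ p).
    exact: is_derive_translate (dK (x + b)).
  rewrite (@continuous_FTC2 _ (fun x => k f (x + b) `^ p) (fun x => K (x + b)) 0 (2 * pi))//.
  - by rewrite add0r EFinB.
  - apply: continuous_subspaceT => x.
    apply: (@continuous_comp _ _ _ (fun y : R => y + b) (fun y => k f y `^ p)); last exact: ck.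
    by apply: cvgD => //; exact: cvg_cst.
  - have cKb : continuous (fun x => K (x + b)) := is_derive_continuous dKb.
    split; first by move=> x _; case: (dKb x).
    + by apply: cvg_at_right_filter; exact: cKb.
    + by apply: cvg_at_left_filter; exact: cKb.
  - by move=> x _; rewrite derive1E; case: (dKb x).
have FTC0 : (\int[leb]_(x in D) (k f x `^ p)%:E = (K (2 * pi + 0) - K 0)%:E)%E.
  by rewrite -FTC; apply: eq_integral => x _; rewrite addr0.
rewrite FTC FTC0; congr EFin.
have per (x : R) : k f (2 * pi + x) = k f x.
  rewrite /circle_point addrC mulr_natl; congr (normc (f (_ * _ +i* (_ * _)))).
    by rewrite mulr2n addrA !cosDpi opprK.
  by rewrite mulr2n addrA !sinDpi opprK.
have dd (x : R) : is_derive x 1 (fun b => K (2 * pi + b) - K b) 0.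
  have dK2 : is_derive x 1 (fun y => K (y + 2 * pi)) (k f x `^ p).
    by apply: is_derive_translate; have := dK (2 * pi + x); rewrite /= per addrC.
  have := is_deriveB dK2 (dK x); rewrite subrr.
  rewrite (_ : (_ - _ : R -> R) = fun b => K (2 * pi + b) - K b)//.
  by apply/funext => b; rewrite -[LHS]/(K (b + 2 * pi) - K b) (addrC b).
exact: (is_derive_0_is_cst a 0 dd).
Qed.

Lemma integral_mean_rot_fin f (u : C) : ccontinuous f -> normc u = 1 ->
  integral_mean p%:E (fun w => f (u * w)) r = integral_mean p%:E f r.
Proof.
move=> cf /polar_form[a ->]; rewrite !integral_mean_finE -(circle_integral_shift a cf).
by under eq_integral do rewrite circle_point_rot.
Qed.

End finite_exponent.

Section all_exponents.
Variables (p : \bar R) (r : R).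
Hypothesis p1 : (1 <= p)%E.
Hypothesis r0 : 0 <= r.

Let pcases : (exists2 p' : R, p = p'%:E & 1 <= p') \/ p = +oo%E.
Proof.
by case: p p1 => [p'|//|//]; rewrite ?lee_fin; [left; exists p'|right].
Qed.

Let sup_le f (M : R) : (forall z, normc z = r -> normc (f z) <= M) ->
  (integral_mean +oo%E f r <= M%:E)%E.
Proof. by move=> fM; apply: ge_ereal_sup => _ [z zr <-]; rewrite lee_fin fM. Qed.

Let sup_ge f (z : C) : normc z = r -> ((normc (f z))%:E <= integral_mean +oo%E f r)%E.
Proof. by move=> zr; apply: ereal_sup_ubound; exists z. Qed.

Lemma integral_mean_cst (c : C) : integral_mean p (fun=> c) r = (normc c)%:E.
Proof.
case: pcases => [[p' -> p'1]|->]; first exact: integral_mean_cst_fin.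
apply/eqP; rewrite eq_le; apply/andP; split; first by apply: sup_le.
by apply: (@sup_ge (fun=> c) (r%:C)); rewrite normc_real ger0_norm.
Qed.

Lemma le_integral_mean f g : ccontinuous f -> ccontinuous g ->
  (forall z, normc z = r -> normc (f z) <= normc (g z)) ->
  (integral_mean p f r <= integral_mean p g r)%E.
Proof.
move=> cf cg fg; case: pcases => [[p' -> p'1]|->].
  by apply: le_integral_mean_fin => // x; apply: fg; exact: normc_circle_point.
apply: ge_ereal_sup => _ [z zr <-]; apply: le_trans (sup_ge g zr).
by rewrite lee_fin fg.
Qed.

Lemma ccontinuous_cst (c : C) : ccontinuous (fun=> c).
Proof. by move=> z e e0; exists 1 => // h _; rewrite subrr ComplexField.Normc.normc0 ltW. Qed.

Lemma integral_mean_bound f (M : R) : ccontinuous f -> 0 <= M ->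
  (forall z, normc z = r -> normc (f z) <= M) -> (integral_mean p f r <= M%:E)%E.
Proof.
move=> cf M0 fM; have := le_integral_mean cf (ccontinuous_cst M%:C).
by rewrite integral_mean_cst normc_real ger0_norm//; apply.
Qed.

Lemma integral_mean_ge0 f : (0 <= integral_mean p f r)%E.
Proof.
case: pcases => [[p' -> p'1]|->]; first exact: poweR_ge0.
apply: le_trans (@sup_ge f r%:C _); first by rewrite lee_fin normc_ge0.
by rewrite normc_real ger0_norm.
Qed.

Lemma integral_mean_fin_num f : ccontinuous f -> integral_mean p f r \is a fin_num.
Proof.
move=> cf; have [M HM] := ccontinuous_bounded r cf.
have M0 : 0 <= M by apply: le_trans (normc_ge0 _) (HM 0 _); rewrite ComplexField.Normc.normc0.
rewrite ge0_fin_numE ?integral_mean_ge0//.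
apply: le_lt_trans (ltry M); apply: integral_mean_bound => // z zr.
by apply: HM; rewrite zr.
Qed.

Lemma integral_meanD f g : ccontinuous f -> ccontinuous g ->
  (integral_mean p (fun z => f z + g z)%R r <= integral_mean p f r + integral_mean p g r)%E.
Proof.
move=> cf cg; case: pcases => [[p' -> p'1]|->]; first exact: integral_meanD_fin.
apply: ge_ereal_sup => _ [z zr <-].
apply: le_trans (leeD (sup_ge f zr) (sup_ge g zr)).
by rewrite -EFinD lee_fin le_normcD.
Qed.

Lemma integral_meanZ (c : C) f : ccontinuous f ->
  (integral_mean p (fun z => c * f z)%R r = (normc c)%:E * integral_mean p f r)%E.
Proof.
move=> cf; case: pcases => [[p' pE p'1]|pE].
  by rewrite pE; exact: integral_meanZ_fin.
have le (b : C) h : ccontinuous h ->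
    (integral_mean p (fun z => b * h z)%R r <= (normc b)%:E * integral_mean p h r)%E.
  move=> ch; rewrite pE; apply: ge_ereal_sup => _ [z zr <-].
  by rewrite normcM EFinM lee_wpmul2l ?lee_fin ?normc_ge0// sup_ge.
apply/eqP; rewrite eq_le le//=.
have [->|c0] := eqVneq c 0.
  by rewrite ComplexField.Normc.normc0 mul0e integral_mean_ge0.
have := le c^-1 _ (ccontinuousZ c cf).
rewrite (_ : (fun z => c^-1 * (c * f z)) = f); last by apply/funext => z; rewrite mulKf.
rewrite ComplexField.Normc.normcV => H.
have cp : 0 < normc c by rewrite lt_neqAle normc_ge0 eq_sym normc_eq0 c0.
by rewrite lee_pdivlMl in H.
Qed.

Lemma integral_mean_rot f (u : C) : ccontinuous f -> normc u = 1 ->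
  integral_mean p (fun w => f (u * w)) r = integral_mean p f r.
Proof.
move=> cf u1; case: pcases => [[p' -> p'1]|->]; first exact: integral_mean_rot_fin.
have u0 : u != 0 by rewrite -normc_eq0 u1 oner_eq0.
congr ereal_sup; apply/seteqP; split=> _ [z /= zr <-].
  by exists (u * z); rewrite //= normcM u1 mul1r.
exists (u^-1 * z); rewrite /= ?mulVKf// normcM ComplexField.Normc.normcV u1 invr1 mul1r//.
Qed.

Lemma integral_mean_seminorm :
  circle_seminorm r (fun f => fine (integral_mean p f r)).
Proof.
split=> [f g cf cg|c f cf|f M cf M0 fM].
- rewrite -fineD ?integral_mean_fin_num// fine_le ?integral_meanD//.
    by apply: integral_mean_fin_num; exact: ccontinuousD.
  by rewrite fin_numD !integral_mean_fin_num.
- by rewrite integral_meanZ// fineM// integral_mean_fin_num.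
- by rewrite -lee_fin fineK ?integral_mean_fin_num// integral_mean_bound.
Qed.

(** The integral means increase with the radius: rotation invariance makes the
    seminorm of [w |-> f (u w)] constant for [|u| = 1], and the maximum principle
    propagates this bound to the real number [t] in the unit disc. *)
Lemma integral_mean_dilation f (t : R) : entire f -> 0 <= t <= 1 ->
  (integral_mean p (fun w => f (t%:C * w)%R) r <= integral_mean p f r)%E.
Proof.
move=> fe t01; have cf := entire_continuous fe.
have := @entire_maximum _ r _ r0 integral_mean_seminorm f (fine (integral_mean p f r)) fe
  _ t%:C.
rewrite normc_real => H.
have {}H : fine (integral_mean p (fun w => f (t%:C * w)) r) <= fine (integral_mean p f r).
  apply: H; last by rewrite ger0_norm; lra.
  by move=> u u1; rewrite integral_mean_rot.
rewrite -lee_fin !fineK in H => //; first exact: integral_mean_fin_num.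
by apply: integral_mean_fin_num; exact: ccontinuous_dilation.
Qed.

End all_exponents.
End integral_means.

(** * The Hausdorff operator on entire functions *)

Section entire_algebra.
Context (R : realType).
Local Notation C := R[i].
Local Notation normc := (@ComplexField.Normc.normc R).
Local Notation normcM := ComplexField.Normc.normcM.
Implicit Types (f g : C -> C).

Lemma entireD f g : entire f -> entire g -> entire (fun z => f z + g z).
Proof. by move=> fe ge z; exact: (derivableD (fe z) (ge z)). Qed.

Lemma entire_cst (c : C) : entire (fun=> c).
Proof. by move=> z; exact: derivable_cst. Qed.

Lemma entire_scale f (k a : C) : entire f -> entire (fun z => k * f (a * z)).
Proof.
move=> /entireP fe; apply/entireP => z; have [d fd] := fe (a * z); exists (k * (d * a)).
move=> e e0; have k1 : 0 < 1 + normc k by have := normc_ge0 k; lra.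
have a1 : 0 < 1 + normc a by have := normc_ge0 a; lra.
have ka : 0 < (1 + normc k) * (1 + normc a) by rewrite mulr_gt0.
have [c c0 Hc] := fd _ (divr_gt0 e0 ka); exists (c / (1 + normc a)) => [|h].
  by rewrite divr_gt0.
rewrite ltr_pdivlMr// => hc.
have hc' : normc (a * h) < c.
  rewrite normcM; apply: le_lt_trans hc.
  by rewrite mulrC ler_wpM2l ?normc_ge0//; lra.
have -> : k * f (a * (z + h)) - k * f (a * z) - k * (d * a) * h =
  k * (f (a * z + a * h) - f (a * z) - d * (a * h)) by rewrite mulrDr; ring.
rewrite normcM; have H := Hc _ hc'.
apply: le_trans (ler_wpM2l (normc_ge0 k) H) _; rewrite normcM.
have -> : normc k * (e / ((1 + normc k) * (1 + normc a)) * (normc a * normc h))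
    = e * normc h * ((normc k * normc a) / ((1 + normc k) * (1 + normc a))) by ring.
rewrite ler_piMr ?mulr_ge0 ?(ltW e0) ?normc_ge0// ler_pdivrMr// mul1r.
by apply: ler_pM; rewrite ?normc_ge0//; lra.
Qed.

End entire_algebra.

Section hausdorff_operator.
Context (R : realType).
Local Notation C := R[i].
Local Notation normc := (@ComplexField.Normc.normc R).
Local Notation normcM := ComplexField.Normc.normcM.
Local Notation Re := complex.Re.
Local Notation Im := complex.Im.
Variable mu : {measure set (measurableTypeR R) -> \bar R}.
Local Notation ray := (`[1%R, +oo[%classic : set (measurableTypeR R)).
Local Notation half := (`]0%R, +oo[%classic : set (measurableTypeR R)).
Hypothesis inv_fin : (\int[mu]_(t in ray) (t^-1)%:E < +oo)%E.
Implicit Types (f g : C -> C) (z w : C) (A B : set (measurableTypeR R)).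

Lemma hausdorff_integrandE f z (t : R) : hausdorff_integrand f z t =
  (t^-1 * Re (f (Re z * t^-1 +i* (Im z * t^-1))))
  +i* (t^-1 * Im (f (Re z * t^-1 +i* (Im z * t^-1)))).
Proof.
rewrite /hausdorff_integrand -fmorphV.
have -> : z * (t^-1)%:C = Re z * t^-1 +i* (Im z * t^-1).
  by case: z => x y; apply/eqP; rewrite eq_complex/= !mulr0 subr0 add0r !eqxx.
case: (f _) => x y; apply/eqP; rewrite eq_complex/= !mul0r subr0 addr0 !eqxx//.
Qed.

Lemma normc_hausdorff_argument z (t : R) : 1 <= t ->
  normc (Re z * t^-1 +i* (Im z * t^-1)) <= normc z.
Proof.
move=> t1; have -> : Re z * t^-1 +i* (Im z * t^-1) = (t^-1)%:C * z.
  case: z => x y; apply/eqP; rewrite eq_complex/= !mul0r subr0 addr0 mulrC eqxx/=.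
  by rewrite mulrC.
rewrite normcM normc_real ler_piMl ?normc_ge0// ger0_norm ?invr_ge0; last by lra.
by rewrite invf_le1//; lra.
Qed.

Lemma measurable_half_line (h : R -> R) : (forall t : R, 0 < t -> {for t, continuous h}) ->
  measurable_fun half (fun t => t^-1 * h t).
Proof.
move=> ch.
have m (g : R -> R) : (forall t : R, 0 < t -> {for t, continuous g}) -> measurable_fun half g.
  move=> cg; apply: open_continuous_measurable_fun; first exact: interval_open.
  by move=> t; rewrite inE/= in_itv/= andbT => /cg.
apply: measurable_funM; apply: m => // t t0.
by apply: inv_continuous; rewrite gt_eqF.
Qed.

Lemma ray_half_line : ray `<=` half.
Proof. by move=> t /=; rewrite !in_itv/= !andbT; exact: lt_le_trans. Qed.

Lemma continuous_mul_inv (x t : R) : 0 < t -> {for t, continuous (fun t : R => x * t^-1)}.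
Proof. by move=> t0; apply: cvgMr; apply: inv_continuous; rewrite gt_eqF. Qed.

Lemma measurable_inv_ray : measurable_fun ray (fun t => t^-1 : R).
Proof.
apply: measurable_funS ray_half_line _ => //.
apply: (eq_measurable_fun (fun t : R => t^-1 * 1)); first by move=> t _; rewrite mulr1.
by apply: measurable_half_line => t _; exact: cst_continuous.
Qed.

Lemma integrable_inv : mu.-integrable ray (EFin \o (fun t => t^-1 : R)).
Proof.
apply/integrableP; split; first by apply/measurable_EFinP; exact: measurable_inv_ray.
rewrite [ltLHS](_ : _ = \int[mu]_(t in ray) (t^-1)%:E)%E//.
apply: eq_integral => t; rewrite inE/= in_itv/= andbT => t1.
by rewrite ger0_norm// invr_ge0; lra.
Qed.

Local Notation curve f z := (fun t : R => f (Re z * t^-1 +i* (Im z * t^-1))).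

Let dominated (h : R -> R) (M : R) : (forall t : R, 0 < t -> {for t, continuous h}) ->
  (forall t, 1 <= t -> `|h t| <= M) ->
  mu.-integrable ray (EFin \o (fun t => t^-1 * h t)).
Proof.
move=> ch hM.
have mray : measurable ray by [].
have iM := integrableZl mray M integrable_inv.
apply: (le_integrable _ _ _ iM) => //.
- by apply/measurable_EFinP; exact: measurable_funS ray_half_line (measurable_half_line ch).
- move=> t; rewrite /= in_itv/= andbT => t1; rewrite lee_fin normrM (normrM M) mulrC.
  by rewrite ler_wpM2r// (le_trans (hM t t1))// ler_norm.
Qed.

Lemma integrable_Re_curve f z : ccontinuous f ->
  mu.-integrable ray (EFin \o (fun t => t^-1 * Re (curve f z t))).
Proof.
move=> cf; have [M HM] := ccontinuous_bounded (normc z) cf.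
apply: (@dominated (fun t => Re (curve f z t)) M) => t t0.
  apply: (@continuous_Re_curve _ f (fun t : R => Re z * t^-1) (fun t : R => Im z * t^-1) t) => //;
    exact: continuous_mul_inv.
apply: le_trans (normr_Re_le _) _; apply: HM; exact: normc_hausdorff_argument.
Qed.

Lemma integrable_Im_curve f z : ccontinuous f ->
  mu.-integrable ray (EFin \o (fun t => t^-1 * Im (curve f z t))).
Proof.
move=> cf; have [M HM] := ccontinuous_bounded (normc z) cf.
apply: (@dominated (fun t => Im (curve f z t)) M) => t t0.
  apply: (@continuous_Im_curve _ f (fun t : R => Re z * t^-1) (fun t : R => Im z * t^-1) t) => //;
    exact: continuous_mul_inv.
apply: le_trans (normr_Im_le _) _; apply: HM; exact: normc_hausdorff_argument.
Qed.

Definition inv_mass A : R := \int[mu]_(t in A) t^-1.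

(** The Hausdorff integral over a set [A] of parameters, through its real and
    imaginary parts; additivity in [A] drives the approximation by finite sums. *)
Definition hausdorff_on A f z : C :=
  (\int[mu]_(t in A) (t^-1 * Re (curve f z t)))
  +i* (\int[mu]_(t in A) (t^-1 * Im (curve f z t))).

Lemma inv_mass_ge0 A : A `<=` ray -> 0 <= inv_mass A.
Proof.
move=> Ar; apply: Rintegral_ge0 => t /Ar; rewrite /= in_itv/= andbT => t1.
by rewrite invr_ge0; lra.
Qed.

Lemma inv_mass_setU A B : measurable A -> measurable B -> A `|` B `<=` ray ->
  [disjoint A & B] -> inv_mass (A `|` B) = inv_mass A + inv_mass B.
Proof.
move=> mA mB AB dAB; apply: Rintegral_setU => //.
by apply: integrableS integrable_inv => //; exact: measurableU.
Qed.

Lemma hausdorff_on_setU A B f z : ccontinuous f ->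
  measurable A -> measurable B -> A `|` B `<=` ray -> [disjoint A & B] ->
  hausdorff_on (A `|` B) f z = hausdorff_on A f z + hausdorff_on B f z.
Proof.
move=> cf mA mB AB dAB; rewrite /hausdorff_on !Rintegral_setU//.
- by apply: integrableS (integrable_Im_curve z cf) => //; exact: measurableU.
- by apply: integrableS (integrable_Re_curve z cf) => //; exact: measurableU.
Qed.

Let Rintegral_near A (h : R -> R) (l e : R) : measurable A -> A `<=` ray ->
  mu.-integrable ray (EFin \o (fun t => t^-1 * h t)) ->
  (forall t, A t -> `|h t - l| <= e) ->
  `|\int[mu]_(t in A) (t^-1 * h t) - inv_mass A * l| <= e * inv_mass A.
Proof.
move=> mA Ar ih hl.
have iA : mu.-integrable A (EFin \o (fun t => t^-1 : R)).
  by apply: integrableS integrable_inv.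
have ihA : mu.-integrable A (EFin \o (fun t => t^-1 * h t)) by apply: integrableS ih.
have ilA : mu.-integrable A (EFin \o (fun t => t^-1 * l)).
  by apply: eq_integrable (integrableZr _ l iA).
have ieA : mu.-integrable A (EFin \o (fun t => e * t^-1)).
  by apply: eq_integrable (integrableZl _ e iA).
rewrite /inv_mass -RintegralZr// -RintegralB// -RintegralZl//.
have idA : mu.-integrable A (EFin \o (fun t => t^-1 * h t - t^-1 * l)).
  by apply: eq_integrable (integrableB _ ihA ilA).
apply: le_trans (le_normr_Rintegral _ idA) _ => //.
apply: le_Rintegral => //.
  by apply: eq_integrable (integrable_abse idA).
move=> t At; have := Ar _ At; rewrite /= in_itv/= andbT => t1.
have tV : 0 <= t^-1 by rewrite invr_ge0 (le_trans ler01).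
by rewrite -mulrBr normrM mulrC (ger0_norm tV) ler_wpM2r ?hl.
Qed.

(** Where the integrand varies little, the integral is close to a multiple of one
    value of [f]. *)
Lemma hausdorff_on_near A f z w (e : R) : ccontinuous f -> measurable A -> A `<=` ray ->
  (forall t, A t -> normc (curve f z t - f w) <= e) ->
  normc (hausdorff_on A f z - (inv_mass A)%:C * f w) <= 2 * e * inv_mass A.
Proof.
move=> cf mA Ar fe; apply: le_trans (normc_le_ReIm _) _.
have -> : 2 * e * inv_mass A = e * inv_mass A + e * inv_mass A by ring.
have sR (u v : C) : Re u - Re v = Re (u - v) by case: u v => [? ?] [? ?].
have sI (u v : C) : Im u - Im v = Im (u - v) by case: u v => [? ?] [? ?].
have mR (x : R) (v : C) : Re (x%:C * v) = x * Re v by case: v => ? ? /=; ring.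
have mI (x : R) (v : C) : Im (x%:C * v) = x * Im v by case: v => ? ? /=; ring.
rewrite -sR -sI mR mI; apply: lerD.
  apply: (Rintegral_near mA Ar (integrable_Re_curve z cf)) => t At.
  by rewrite sR; apply: le_trans (normr_Re_le _) (fe t At).
apply: (Rintegral_near mA Ar (integrable_Im_curve z cf)) => t At.
by rewrite sI; apply: le_trans (normr_Im_le _) (fe t At).
Qed.

Section approximation.
Variables (f : C -> C) (rho eta d : R).
Hypothesis fe : entire f.
Hypothesis d0 : 0 < d.
Hypothesis f_unif : forall z h, normc z <= rho -> normc h <= d * rho ->
  normc (f (z + h) - f z) <= eta.

Let cf := entire_continuous fe.

(** Every requirement is additive in [A], so that the ray can be treated piece by
    piece. *)
Definition approximable A : Prop := exists g : C -> C, [/\ entire g,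
  forall z, normc z <= rho -> normc (hausdorff_on A f z - g z) <= 2 * eta * inv_mass A &
  forall (p : \bar R) (r : R), (1 <= p)%E -> 0 <= r ->
    (integral_mean p g r <= (inv_mass A)%:E * integral_mean p f r)%E].

(** On a set of parameters where [1/t] is nearly a constant [s], the function
    [m f(s z)] works, and the monotonicity of the integral means bounds its means. *)
Lemma approximable_piece A (s : R) : measurable A -> A `<=` ray -> 0 <= s <= 1 ->
  (forall t, A t -> `|t^-1 - s| <= d) -> approximable A.
Proof.
move=> mA Ar s01 As; have m0 := inv_mass_ge0 Ar.
exists (fun z => (inv_mass A)%:C * f (s%:C * z)); split.
- exact: entire_scale.
- move=> z zr; apply: hausdorff_on_near => // t At.
  have -> : Re z * t^-1 +i* (Im z * t^-1) = s%:C * z + (t^-1 - s)%:C * z.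
    rewrite -mulrDl -rmorphD/= subrKC; case: z {zr} => x y.
    by apply/eqP; rewrite eq_complex/= !mul0r subr0 addr0 mulrC eqxx/= mulrC.
  have z0 := normc_ge0 z.
  apply: f_unif; rewrite normcM normc_real.
    by apply: le_trans zr; rewrite ler_piMl// ger0_norm; lra.
  by apply: ler_pM => //; exact: As.
- move=> p r p1 r0.
  rewrite (@integral_meanZ _ p r p1 r0 _ (fun z => f (s%:C * z))); last exact: ccontinuous_dilation.
  rewrite normc_real ger0_norm// lee_wpmul2l ?lee_fin//.
  exact: integral_mean_dilation.
Qed.

Lemma approximable_setU A B : measurable A -> measurable B -> A `|` B `<=` ray ->
  [disjoint A & B] -> approximable A -> approximable B -> approximable (A `|` B).
Proof.
move=> mA mB ABr dAB [g [ge gA gm]] [h [he hB hm]].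
have cg := entire_continuous ge; have ch := entire_continuous he.
have [Ar Br] : A `<=` ray /\ B `<=` ray by split=> t ?; apply: ABr; [left|right].
exists (fun z => g z + h z); split.
- exact: entireD.
- move=> z zr; rewrite hausdorff_on_setU// inv_mass_setU//.
  rewrite opprD addrACA mulrDr; apply: le_trans (le_normcD _ _) _.
  by apply: lerD; [exact: gA|exact: hB].
- move=> p r p1 r0; rewrite inv_mass_setU//.
  apply: le_trans (integral_meanD r p1 cg ch) _.
  rewrite EFinD ge0_muleDl ?lee_fin ?inv_mass_ge0//.
  by apply: leeD; [exact: gm|exact: hm].
Qed.

(** Cut the ray where [1/t] takes the values [1 - n/N], with [1/N <= d]. The last piece
    is unbounded, and its parameter values [1/t] fill [[0, 1/N]]. *)
Lemma approximable_ray : approximable ray.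
Proof.
(* the cut points b n are the reciprocals of 1 - n/N *)
pose N := (Num.bound d^-1).+1.
have N0 : 0 < N%:R :> R by rewrite ltr0n.
have Nd : N%:R^-1 <= d.
  rewrite -[leRHS]invrK lef_pV2 ?posrE ?invr_gt0//.
  have di : 0 <= d^-1 by rewrite invr_ge0 ltW.
  by apply: le_trans (ltW (archi_boundP di)) _; rewrite ler_nat.
pose b (n : nat) : R := N%:R / (N%:R - n%:R).
have den (n : nat) : (n < N)%N -> 0 < N%:R - n%:R :> R by rewrite subr_gt0 ltr_nat.
have bpos n : (n < N)%N -> 0 < b n by move=> nN; rewrite divr_gt0// den.
have bV n : (n < N)%N -> (b n)^-1 = 1 - n%:R * N%:R^-1.
  by move=> nN; rewrite /b invfM invrK mulrC mulrBl mulfV ?gt_eqF.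
have b1 n : (n < N)%N -> 1 <= b n.
  by move=> nN; rewrite ler_pdivlMr ?den// mul1r lerBlDr lerDl ler0n.
have bs n : (n.+1 < N)%N -> b n <= b n.+1.
  move=> nN; have nN' := ltnW nN.
  rewrite -[leLHS]invrK -[leRHS]invrK lef_pV2 ?posrE ?invr_gt0 ?bpos// !bV//.
  by rewrite lerD2l lerN2 ler_wpM2r ?invr_ge0 ?ler0n// ler_nat.
have partial n : (n < N)%N -> approximable (`[1, b n[%classic : set (measurableTypeR R)).
  elim: n => [|n IH] nN.
    apply: (@approximable_piece _ 0) => //; first by move=> t /=; rewrite !in_itv/= andbT => /andP[].
      by rewrite lexx ler01.
    by move=> t /=; rewrite in_itv/= /b subr0 divff ?gt_eqF//; lra.
  have nN' := ltnW nN; have bn1 := b1 _ nN'; have bns := bs n nN.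
  have -> : `[1, b n.+1[%classic = `[1, b n[%classic `|` `[b n, b n.+1[%classic :> set R.
    apply/seteqP; split=> t /=; rewrite !in_itv/=.
      by move=> /andP[t1 tb]; have [tn|tn] := ltP t (b n); [left|right]; rewrite ?t1 ?tb.
    by case=> /andP[? ?]; lra.
  apply: approximable_setU => //.
  - by move=> t; rewrite /= !in_itv/= andbT; case=> /andP[]; lra.
  - apply/disj_setPS => t []; rewrite /= !in_itv/=; lra.
  - exact: IH.
  apply: (@approximable_piece _ (b n)^-1) => //.
  - by move=> t; rewrite /= !in_itv/= andbT; lra.
  - by rewrite invr_ge0 (ltW (bpos _ nN'))/= invf_le1// bpos.
  move=> t; rewrite /= in_itv/= => /andP[tb tb'].
  have t0 : 0 < t by apply: lt_le_trans tb; exact: bpos.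
  have H1 : t^-1 <= (b n)^-1 by rewrite lef_pV2 ?posrE// bpos.
  have H2 : (b n.+1)^-1 < t^-1 by rewrite ltf_pV2 ?posrE// bpos.
  apply: le_trans Nd; move: H1 H2; rewrite !bV// ler_norml -natr1 mulrDl mul1r; lra.
have -> : ray = `[1, b N.-1[%classic `|` `[b N.-1, +oo[%classic.
  apply/seteqP; split=> t /=; rewrite !in_itv/= !andbT.
    by move=> t1; have [tn|tn] := ltP t (b N.-1); [left; rewrite t1|right].
  by case=> [/andP[? ?]|]//; have := b1 N.-1 (ltnSn _); lra.
have b1N := b1 N.-1 (ltnSn _).
apply: approximable_setU => //.
- by move=> t; rewrite /= !in_itv/= !andbT; case=> [/andP[]|]; lra.
- by apply/disj_setPS => t []; rewrite /= !in_itv/= !andbT; lra.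
- exact: partial.
apply: (@approximable_piece _ (b N.-1)^-1) => //.
- by move=> t; rewrite /= !in_itv/= !andbT; lra.
- by rewrite invr_ge0 (ltW (bpos _ (ltnSn _)))/= invf_le1// bpos.
move=> t; rewrite /= in_itv/= andbT => tb.
have t0 : 0 < t by lra.
have H1 : t^-1 <= (b N.-1)^-1 by rewrite lef_pV2 ?posrE// bpos.
have H2 : 0 < t^-1 by rewrite invr_gt0.
have bN : (b N.-1)^-1 = N%:R^-1.
  by rewrite /b invfM invrK -[N in N%:R - _]prednK// -natr1 addrAC subrr add0r mulr1.
by apply: le_trans Nd; rewrite bN in H1 *; rewrite ler_norml; lra.
Qed.

End approximation.

Local Notation c := (inv_mass ray).

Lemma hausdorff_on_approx f (rho e : R) : entire f -> 0 < e ->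
  exists g : C -> C, [/\ entire g,
    forall z, normc z <= rho -> normc (hausdorff_on ray f z - g z) <= e &
    forall (p : \bar R) (r : R), (1 <= p)%E -> 0 <= r ->
      (integral_mean p g r <= c%:E * integral_mean p f r)%E].
Proof.
move=> fe e0; have c0 : 0 <= c by exact: inv_mass_ge0.
(* adding 1 keeps the quotient meaningful when the mass c vanishes *)
have eta0 : 0 < e / (2 * (1 + c)) by rewrite divr_gt0// mulr_gt0//; lra.
have [a a0 Ha] := ccontinuous_unif rho (entire_continuous fe) eta0.
have r1 : 0 < 1 + `|rho| by have := normr_ge0 rho; lra.
have d0 : 0 < a / 2 / (1 + `|rho|) by rewrite !divr_gt0.
have [|g [ge ga gm]] := @approximable_ray f rho (e / (2 * (1 + c))) (a / 2 / (1 + `|rho|)) fe d0.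
  move=> z h zr hd; apply: Ha => //; apply: le_lt_trans hd _.
  have rr := ler_norm rho.
  rewrite mulrAC ltr_pdivrMr//; apply: le_lt_trans (_ : a / 2 * (1 + `|rho|) < _).
    by rewrite ler_wpM2l//; lra.
  by rewrite ltr_pM2r//; lra.
exists g; split=> // z /ga H; apply: le_trans H _.
have c1 : 0 < 1 + c by lra.
have -> : 2 * (e / (2 * (1 + c))) * c = e * (c / (1 + c)) by field; rewrite gt_eqF.
by rewrite ler_piMr ?(ltW e0)// ler_pdivrMr//; lra.
Qed.

(** Differentiation under the integral sign is replaced by uniform approximation. *)
Lemma entire_hausdorff_on f : entire f -> entire (hausdorff_on ray f).
Proof.
move=> fe; apply: entire_of_approx => r e e0.
have [g [ge gf _]] := hausdorff_on_approx r fe e0.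
by exists g => // z /gf; rewrite normcB.
Qed.

Lemma integral_mean_hausdorff_on f (p : \bar R) (r : R) : entire f -> (1 <= p)%E -> 0 <= r ->
  (integral_mean p (hausdorff_on ray f) r <= c%:E * integral_mean p f r)%E.
Proof.
move=> fe p1 r0; apply/lee_addgt0Pr => e e0.
have [g [ge gf gm]] := hausdorff_on_approx r fe e0.
have ch := entire_continuous (entire_hausdorff_on fe).
have cg := entire_continuous ge; have cd := ccontinuousB ch cg.
have -> : hausdorff_on ray f = fun z => g z + (hausdorff_on ray f z - g z).
  by apply/funext => z; rewrite subrKC.
apply: le_trans (integral_meanD r p1 cg cd) _; apply: leeD; first exact: gm.
by apply: integral_mean_bound => //; [exact: ltW|move=> z zr; apply: gf; rewrite zr].
Qed.

End hausdorff_operator.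

(** * Norms of Fock spaces *)

Section fock_norms.
Context (R : realType).
Local Notation C := R[i].
Local Notation leb := (@lebesgue_measure R).
Local Notation normc := (@ComplexField.Normc.normc R).
Local Notation normcM := ComplexField.Normc.normcM.
Local Notation half := (`[0%R, +oo[%classic : set (measurableTypeR R)).
Local Notation outer := (`[(1 / 2)%R, 1%R]%classic : set (measurableTypeR R)).
Implicit Types (f g : C -> C).

(** Gives measurability of the weight, and a positive lower bound for it near the
    origin. *)
Lemma continuously_differentiable_continuous (phi : R -> R) :
  continuously_differentiable phi -> {within `[0, +oo[, continuous phi}.
Proof.
move=> [dphi [_ dP]]; apply/subspace_continuousP => r rI.
have r0 : 0 <= r by move: rI; rewrite /= in_itv/= andbT.
have /cvgrPdist_le/(_ _ ltr01)/nbhs_ballP[c /= c0 Hc] := dP r r0.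
have D0 : 0 < 1 + `|dphi r| by have := normr_ge0 (dphi r); lra.
apply/(@cvgrPdist_le _ _ _ _ (within_filter _ (nbhs_filter r))) => e e0; apply/nbhs_ballP.
exists (Num.min c (e / (1 + `|dphi r|))); first by rewrite /= lt_min c0 divr_gt0.
move=> s; rewrite /ball/= lt_min ltr_pdivlMr// => /andP[sc se].
rewrite in_itv/= andbT => s0.
have [->|sr] := eqVneq s r; first by rewrite subrr normr0 ltW.
have H := Hc s sc sr s0.
have sr0 : s - r != 0 by rewrite subr_eq0.
have q : `|(phi s - phi r) / (s - r)| <= 1 + `|dphi r|.
  rewrite -[X in `|X|](subrK (dphi r)); apply: le_trans (ler_normD _ _) _.
  by rewrite lerD2r distrC.
rewrite distrC -[phi s - phi r](divfK sr0) normrM.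
apply: le_trans (ler_wpM2r (normr_ge0 _) q) _.
by rewrite mulrC (distrC s); exact: ltW.
Qed.

Section norm.
Variables (p q : \bar R) (phi : R -> R).
Hypothesis p1 : (1 <= p)%E.
Hypothesis q1 : (1 <= q)%E.
Hypothesis phiw : is_weight q phi.

Let qcases : (exists2 q' : R, q = q'%:E & 1 <= q') \/ q = +oo%E.
Proof.
by case: q q1 => [q'|//|//]; rewrite ?lee_fin; [left; exists q'|right].
Qed.

(** Moves the radius into the function, where continuity in the radius is continuity
    of a seminorm under dilations. *)
Lemma integral_mean_unit_circle f (r : R) : 0 <= r ->
  integral_mean p (fun w => f (r%:C * w)) 1 = integral_mean p f r.
Proof.
move=> r0; case: p p1 => [p'| |//] _.
  rewrite !integral_mean_finE.
  suff E x : r%:C * circle_point 1 x = circle_point r x by under eq_integral do rewrite E.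
  by rewrite /circle_point; apply/eqP; rewrite eq_complex/= !mul0r !mul1r subr0 addr0 !eqxx.
have nr : normc r%:C = r by rewrite normc_real ger0_norm.
congr ereal_sup; apply/seteqP; split=> _ [z /= zr <-].
  by exists (r%:C * z); rewrite //= normcM nr zr mulr1.
have [r00|rn0] := eqVneq r 0.
  have -> : z = 0 by apply/eqP; rewrite -normc_eq0 zr r00.
  by exists 1; rewrite /= ?expr1n ?expr0n/= ?addr0 ?sqrtr1// r00 mul0r.
have rC : r%:C != 0 :> C by rewrite -normc_eq0 nr.
exists (r%:C^-1 * z); last by rewrite mulVKf.
by rewrite /= normcM ComplexField.Normc.normcV nr zr mulVf.
Qed.

Lemma continuous_integral_mean f : ccontinuous f ->
  continuous (fun r : R => fine (integral_mean p (fun w => f (r%:C * w)) 1)).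
Proof.
move=> cf r; apply/cvgrPdist_le => e e0.
have [c c0 Hc] := seminorm_dilation_continuous ler01 (integral_mean_seminorm p1 ler01) r%:C cf e0.
apply/nbhs_ballP; exists c => //= s; rewrite /ball/= => sc.
have := Hc (s - r)%:C; rewrite normc_real distrC => /(_ sc).
by rewrite -rmorphD/= subrKC distrC.
Qed.

Lemma measurable_weight (q' : R) : measurable_fun half (fun r => expR (- (q' * phi r)) * r).
Proof.
have [dphi _ _] := phiw; have cphi := continuously_differentiable_continuous dphi.
apply: measurable_funM => //.
apply: (measurableT_comp (@measurable_expR _)).
apply: (measurableT_comp (@oppr_measurable _ _)).
apply: measurable_funM => //; apply: subspace_continuous_measurable_fun => //.
Qed.

Lemma measurable_fock_integrand f (q' : R) : ccontinuous f ->
  measurable_fun half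
    (fun r => (integral_mean p f r `^ q' * (expR (- (q' * phi r)) * r)%:E)%E).
Proof.
move=> cf.
pose m (r : R) := fine (integral_mean p (fun w => f (r%:C * w)) 1).
apply: (eq_measurable_fun (fun r => ((m r `^ q') * (expR (- (q' * phi r)) * r))%:E)).
  move=> r; rewrite inE/= in_itv/= andbT => r0.
  rewrite EFinM /m integral_mean_unit_circle// -poweR_EFin fineK//.
  exact: integral_mean_fin_num.
apply/measurable_EFinP; apply: measurable_funM; last exact: measurable_weight.
apply: (measurableT_comp (@measurable_powR _ _)); apply: measurable_funTS.
exact: continuous_measurable_fun (continuous_integral_mean cf).
Qed.

Lemma fock_norm_ge0 f : (0 <= fock_norm p q phi f)%E.
Proof.
case: qcases => [[q' -> _]|->]; first exact: poweR_ge0.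
apply: (@le_trans _ _ (integral_mean p f 0 * (expR (- phi 0))%:E)%E); last first.
  by apply: ereal_sup_ubound; exists 0 => //=; rewrite in_itv/= lexx.
by rewrite mule_ge0 ?lee_fin ?expR_ge0// integral_mean_ge0.
Qed.

(** A bound for the means at every radius passes to the norm by monotonicity
    alone. *)
Lemma fock_norm_dominated f g (a : R) : ccontinuous f -> ccontinuous g -> 0 <= a ->
  (forall r, 0 <= r -> (integral_mean p f r <= a%:E * integral_mean p g r)%E) ->
  (fock_norm p q phi f <= a%:E * fock_norm p q phi g)%E.
Proof.
move=> cf cg a0 fg; case: qcases => [[q' -> q'1]|->]; last first.
  apply: ge_ereal_sup => _ [r rr <-].
  have r0 : 0 <= r by move: rr; rewrite /= in_itv/= andbT.
  apply: le_trans (_ : a%:E * (integral_mean p g r * (expR (- phi r))%:E) <= _)%E.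
    by rewrite muleA lee_wpmul2r ?lee_fin ?expR_ge0// fg.
  by rewrite lee_wpmul2l ?lee_fin//; apply: ereal_sup_ubound; exists r.
have q0 : 0 < q' by lra.
have w0 r : half r -> (0 <= (expR (- (q' * phi r)) * r)%:E)%E.
  by rewrite /= in_itv/= andbT => r0; rewrite lee_fin mulr_ge0// expR_ge0.
have I0 h : (0 <= \int[leb]_(r in half) (integral_mean p h r `^ q' *
    (expR (- (q' * phi r)) * r)%:E))%E.
  by apply: integral_ge0 => r /w0 H; rewrite mule_ge0// poweR_ge0.
have -> : (a%:E * fock_norm p q'%:E phi g = (\int[leb]_(r in half)
    ((a `^ q')%:E * (integral_mean p g r `^ q' * (expR (- (q' * phi r)) * r)%:E))) `^ q'^-1)%E.
  rewrite ge0_integralZl_EFin ?powR_ge0//.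
  - rewrite poweRM ?lee_fin ?powR_ge0// poweR_EFin -powRrM mulfV ?gt_eqF// powRr1//.
  - by move=> r /w0 H; rewrite mule_ge0// poweR_ge0.
  - exact: measurable_fock_integrand.
apply: gt0_ler_poweR.
- by rewrite invr_ge0 ltW.
- by rewrite in_itv/= leey andbT I0.
- rewrite in_itv/= leey andbT; apply: integral_ge0 => r /w0 H.
  by rewrite !mule_ge0// ?poweR_ge0 ?lee_fin ?powR_ge0.
apply: ge0_le_integral => //.
- by move=> r /w0 H; rewrite mule_ge0// poweR_ge0.
- exact: measurable_fock_integrand.
- apply: measurable_funeM; exact: measurable_fock_integrand.
- move=> r rr; rewrite muleA; apply: lee_wpmul2r; first exact: w0.
  have r0 : 0 <= r by move: rr; rewrite /= in_itv/= andbT.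
  rewrite -poweR_EFin -poweRM ?lee_fin ?integral_mean_ge0//.
  apply: gt0_ler_poweR; rewrite ?in_itv/= ?leey ?andbT ?mule_ge0 ?lee_fin ?integral_mean_ge0 ?(ltW q0)//.
  exact: fg.
Qed.

Lemma fock_cst (c : C) : fock p q phi (fun=> c).
Proof.
split; first exact: entire_cst.
have [_ phi0] := phiw; case: qcases => [[q' -> q'1] Hw|-> _].
  apply: poweR_lty.
  have -> : (\int[leb]_(r in half) (integral_mean p (fun=> c) r `^ q' *
      (expR (- (q' * phi r)) * r)%:E) = (normc c `^ q')%:E * weight_integral q' phi)%E.
    rewrite -ge0_integralZl_EFin ?powR_ge0//.
    - apply: eq_integral => r; rewrite inE/= in_itv/= andbT => r0.
      by rewrite integral_mean_cst.
    - by move=> r; rewrite /= in_itv/= andbT => r0; rewrite lee_fin mulr_ge0// expR_ge0.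
    - by apply/measurable_EFinP; exact: measurable_weight.
  by rewrite lte_mul_pinfty// lee_fin powR_ge0.
apply: le_lt_trans (ltry (normc c)); apply: ge_ereal_sup => _ [r rr <-].
have r0 : 0 <= r by move: rr; rewrite /= in_itv/= andbT.
rewrite integral_mean_cst// -EFinM lee_fin ler_piMr ?normc_ge0//.
by rewrite -expR0 ler_expR oppr_le0 phi0.
Qed.

(** For finite [q], the annulus [1/2 <= r <= 1] already contributes; [w] comes
    from the maximum of [phi] on the unit interval. For infinite [q] the centre suffices. *)
Lemma fock_norm_lower : exists2 w : R, 0 < w & forall f (A : R), ccontinuous f -> 0 <= A ->
  (forall r, 0 <= r <= 1 -> (A%:E <= integral_mean p f r)%E) ->
  ((A * w)%:E <= fock_norm p q phi f)%E.
Proof.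
have [dphi phi0 Hw] := phiw; have cphi := continuously_differentiable_continuous dphi.
case: qcases => [[q' qE q'1]|qE]; last first.
  rewrite qE; exists (expR (- phi 0)); first exact: expR_gt0.
  move=> f A cf A0 fA; apply: (@le_trans _ _ (integral_mean p f 0 * (expR (- phi 0))%:E)%E); last first.
    by apply: ereal_sup_ubound; exists 0 => //=; rewrite in_itv/= lexx.
  by rewrite EFinM lee_wpmul2r ?lee_fin ?expR_ge0// fA// lexx ler01.
have q0 : 0 < q' by lra.
have c01 : {within `[0, 1], continuous phi}.
  by apply: continuous_subspaceW cphi => r /=; rewrite !in_itv/= andbT => /andP[].
have [b _ Hb] := EVT_max (@ler01 R) c01.
pose B := expR (- (q' * phi b)) / 2.
have B0 : 0 < B by rewrite divr_gt0// expR_gt0.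
rewrite qE; exists ((B / 2) `^ q'^-1); first by rewrite powR_gt0// divr_gt0.
move=> f A cf A0 fA.
have h0 (r : R) : 1 / 2 <= r -> 0 <= r by lra.
have Isub : outer `<=` half by move=> r; rewrite /= !in_itv/= andbT => /andP[r1 _]; exact: h0.
have w0 r : half r -> (0 <= (expR (- (q' * phi r)) * r)%:E)%E.
  by rewrite /= in_itv/= andbT => r0; rewrite lee_fin mulr_ge0// expR_ge0.
have -> : (A * (B / 2) `^ q'^-1)%:E = ((A `^ q' * (B / 2))%:E `^ q'^-1)%E.
  have B2 : 0 <= B / 2 by rewrite ltW// divr_gt0.
  rewrite poweR_EFin (@powRM _ (A `^ q') (B / 2)) ?powR_ge0//.
  by rewrite -powRrM mulfV ?gt_eqF// powRr1.
have AB0 : (0 <= (A `^ q' * (B / 2))%:E)%E.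
  by rewrite lee_fin mulr_ge0 ?powR_ge0// ltW// divr_gt0.
apply: gt0_ler_poweR.
- by rewrite invr_ge0 ltW.
- by rewrite in_itv/= leey andbT.
- rewrite in_itv/= leey andbT; apply: integral_ge0 => r /w0 H.
  by rewrite mule_ge0// poweR_ge0.
have wf0 r : half r -> (0 <= integral_mean p f r `^ q' * (expR (- (q' * phi r)) * r)%:E)%E.
  by move=> /w0 H; rewrite mule_ge0// poweR_ge0.
have mI : measurable outer by exact: measurable_itv.
have mhalf : measurable half by exact: measurable_itv.
have le1 := ge0_subset_integral leb mI mhalf (measurable_fock_integrand q' cf) wf0 Isub.
apply: le_trans le1.
have -> : (A `^ q' * (B / 2))%:E = (\int[leb]_(r in outer) (A `^ q' * B)%:E)%E.
  rewrite integral_cst// /= lebesgue_measure_itv/= lte_fin ifT; last by lra.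
  by rewrite -EFinB -EFinM; congr EFin; field.
apply: ge0_le_integral => //.
- by move=> r _; rewrite lee_fin mulr_ge0 ?powR_ge0// ltW.
- exact: measurable_funS (measurable_fock_integrand q' cf).
- move=> r; rewrite /= in_itv/= => /andP[r1 r2].
  have r0 : 0 <= (r : R) by exact: h0.
  rewrite EFinM; apply: lee_pmul.
  + by rewrite lee_fin powR_ge0.
  + by rewrite lee_fin ltW.
  + rewrite -poweR_EFin; apply: gt0_ler_poweR; rewrite ?in_itv/= ?leey ?andbT ?lee_fin ?integral_mean_ge0 ?(ltW q0)//.
    by apply: fA; rewrite r0.
  + rewrite lee_fin /B; apply: ler_pM; rewrite ?expR_ge0 ?invr_ge0//; last by move: r1; rewrite div1r.
    by rewrite ler_expR lerN2 ler_pM2l// Hb// in_itv/= r0.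
Qed.

End norm.
End fock_norms.

(** * Averages of powers *)

Section geometric_averages.
Context (R : realType).

(** The factor by which the Cesaro mean of order [n] multiplies constants, and a
    bound for its norm. *)
Definition cesaro_power (c : R) (n : nat) : R := n%:R^-1 * \sum_(1 <= k < n.+1) c ^+ k.

Lemma cesaro_power_ge0 (c : R) n : 0 <= c -> 0 <= cesaro_power c n.
Proof.
by move=> c0; rewrite mulr_ge0 ?invr_ge0 ?ler0n// sumr_ge0// => k _; exact: exprn_ge0.
Qed.

Lemma cvg_cesaro_power (c : R) : 0 <= c < 1 -> cesaro_power c @ \oo --> 0.
Proof.
move=> /andP[c0 c1]; have c10 : 0 < 1 - c by lra.
have S n : \sum_(1 <= k < n.+1) c ^+ k <= (1 - c)^-1.
  rewrite -[leRHS]mul1r ler_pdivlMr//.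
  suff -> : (\sum_(1 <= k < n.+1) c ^+ k) * (1 - c) = c - c ^+ n.+1.
    by have := exprn_ge0 n.+1 c0; lra.
  elim: n => [|n IH]; first by rewrite big_geq// expr1 subrr mul0r.
  rewrite big_nat_recr//= mulrDl IH [c ^+ n.+2]exprSr; ring.
rewrite -cvg_shiftS.
apply: (@squeeze_cvgr _ _ _ _ (cst 0) ((1 - c)^-1 *: @harmonic R)).
- apply: nearW => n /=; rewrite cesaro_power_ge0//=.
  by rewrite /cesaro_power mulrC; apply: ler_wpM2r; rewrite ?invr_ge0 ?S.
- exact: cvg_cst.
- by rewrite -[X in _ --> X](scaler0 _ (1 - c)^-1); apply: cvgZr; exact: cvg_harmonic.
Qed.

(** By Bernoulli's inequality the averages grow at least linearly in [n]. *)
Lemma cesaro_power_unbounded (c K : R) (n0 : nat) : 1 < c ->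
  exists2 n, (n0 <= n)%N & K < cesaro_power c n.
Proof.
move=> c1; have bern k : 1 + k%:R * (c - 1) <= c ^+ k.
  elim: k => [|k IH]; first by rewrite mul0r addr0 expr0.
  rewrite exprSr -natr1.
  have H : (1 + k%:R * (c - 1)) * c <= c ^+ k * c by rewrite ler_wpM2r//; lra.
  apply: le_trans H; rewrite -subr_ge0.
  have -> : (1 + k%:R * (c - 1)) * c - (1 + (k%:R + 1) * (c - 1)) = k%:R * (c - 1) ^+ 2 by ring.
  by rewrite mulr_ge0 ?ler0n ?sqr_ge0.
have S n : n%:R * (n%:R * (c - 1) / 2) <= \sum_(1 <= k < n.+1) c ^+ k.
  elim: n => [|n IH]; first by rewrite big_geq// mul0r.
  rewrite big_nat_recr//=; apply: le_trans (lerD IH (bern n.+1)).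
  rewrite -natr1; have := ler0n R n; nra.
have c10 : 0 < c - 1 by lra.
pose k := Num.bound (`|K| * 2 / (c - 1)); exists (maxn n0 k.+1); first exact: leq_maxl.
set n := maxn _ _.
have kn : `|K| * 2 / (c - 1) < n%:R.
  apply: lt_le_trans (archi_boundP _) _; first by rewrite divr_ge0 ?mulr_ge0// ltW.
  by rewrite ler_nat; apply: leq_trans (leqnSn _) (leq_maxr _ _).
have n_gt0 : 0 < n%:R :> R by rewrite ltr0n; apply: leq_trans (leq_maxr _ _).
rewrite /cesaro_power mulrC ltr_pdivlMr//; apply: lt_le_trans (S n).
rewrite [ltLHS]mulrC ltr_pM2l//; apply: le_lt_trans (ler_norm _) _.
by move: kn; rewrite ltr_pdivrMr// -ltr_pdivlMr.
Qed.

End geometric_averages.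

(** * Reduction to the ray, iterates and means *)

Section half_line.
Context (R : realType).
Local Notation C := R[i].
Local Notation normc := (@ComplexField.Normc.normc R).
Local Notation Re := complex.Re.
Local Notation Im := complex.Im.
Variable mu : {measure set (measurableTypeR R) -> \bar R}.
Hypothesis mu_lt1 : mu `]0, 1[%classic = 0%E.
Local Notation ray := (`[1%R, +oo[%classic : set (measurableTypeR R)).
Local Notation half := (`]0%R, +oo[%classic : set (measurableTypeR R)).
Local Notation gap := (`]0%R, 1%R[%classic : set (measurableTypeR R)).
Implicit Types (f g : C -> C) (z : C).

Lemma half_line_setD : half `\` gap = ray.
Proof.
have E (t : R) : (0 < t) && ~~ ((0 < t) && (t < 1)) = (1 <= t).
  by rewrite negb_and -!leNgt; apply/idP/idP => [|H]; [case/andP => H /orP[]|]; lra.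
apply/seteqP; split=> t; rewrite /= !in_itv/= !andbT -E; last by move=> /andP[? /negP].
by case=> -> /negP ->.
Qed.

Lemma integrable_half_line (h : R -> R) :
  (forall t : R, 0 < t -> {for t, continuous h}) ->
  mu.-integrable half (EFin \o (fun t => t^-1 * h t)) <->
  mu.-integrable ray (EFin \o (fun t => t^-1 * h t)).
Proof.
move=> ch; rewrite -half_line_setD; apply: negligible_integrable => //.
by apply/measurable_EFinP; exact: measurable_half_line.
Qed.

Lemma Rintegral_half_line (h : R -> R) :
  mu.-integrable half (EFin \o h) ->
  \int[mu]_(t in half) h t = \int[mu]_(t in ray) h t.
Proof.
by move=> ih; rewrite -half_line_setD /Rintegral (@negligible_integral _ _ _ _ _ gap).
Qed.

Lemma cintegrable_hausdorff f z :
  (\int[mu]_(t in ray) (t^-1)%:E < +oo)%E -> ccontinuous f ->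
  cintegrable mu half (hausdorff_integrand f z).
Proof.
move=> inv_fin cf; split.
- rewrite (_ : (fun _ => _) =
    EFin \o (fun t => t^-1 * Re (f (Re z * t^-1 +i* (Im z * t^-1))))).
    apply/integrable_half_line; last exact: integrable_Re_curve.
    move=> t t0; apply: (@continuous_Re_curve _ f (fun t : R => Re z * t^-1) (fun t : R => Im z * t^-1) t) => //;
      exact: continuous_mul_inv.
  by apply/funext => t; rewrite hausdorff_integrandE.
- rewrite (_ : (fun _ => _) =
    EFin \o (fun t => t^-1 * Im (f (Re z * t^-1 +i* (Im z * t^-1))))).
    apply/integrable_half_line; last exact: integrable_Im_curve.
    move=> t t0; apply: (@continuous_Im_curve _ f (fun t : R => Re z * t^-1) (fun t : R => Im z * t^-1) t) => //;
      exact: continuous_mul_inv.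
  by apply/funext => t; rewrite hausdorff_integrandE.
Qed.

(** The parameters below 1 form a null set. *)
Lemma hausdorffE f : (\int[mu]_(t in ray) (t^-1)%:E < +oo)%E -> ccontinuous f ->
  hausdorff mu f = hausdorff_on mu ray f.
Proof.
move=> inv_fin cf; apply/funext => z; have [iR iI] := cintegrable_hausdorff z inv_fin cf.
rewrite /hausdorff /cintegral (Rintegral_half_line iR) (Rintegral_half_line iI).
rewrite /hausdorff_on; congr (_ +i* _); apply: eq_Rintegral => t _;
  by rewrite hausdorff_integrandE.
Qed.

(** Testing the operator on the constant 1 shows that it can only be defined when
    [1/t] is integrable. *)
Lemma inv_integral_fin : cintegrable mu half (hausdorff_integrand (fun=> 1) 0) ->
  (\int[mu]_(t in ray) (t^-1)%:E < +oo)%E.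
Proof.
case=> iR _.
have : mu.-integrable ray (EFin \o (fun t : R => t^-1 * cst 1 t)).
  apply/integrable_half_line; first by move=> t _; exact: cst_continuous.
  apply: eq_integrable iR => //t _.
  by rewrite hausdorff_integrandE.
move=> /integrableP[_]; congr (_ < _)%E; apply: eq_integral => t.
rewrite inE/= in_itv/= andbT => t1.
by rewrite mulr1 ger0_norm// invr_ge0; apply: le_trans t1.
Qed.

Section finite_mass.
Hypothesis inv_fin : (\int[mu]_(t in ray) (t^-1)%:E < +oo)%E.
Local Notation T := (hausdorff mu).
Local Notation c := (inv_mass mu ray).

Lemma inv_massE : (\int[mu]_(t in ray) (t^-1)%:E = c%:E)%E.
Proof. by rewrite /inv_mass /Rintegral fineK// (integrable_fin_num _ (integrable_inv inv_fin)). Qed.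

Lemma hausdorff_linear (a : C) f g : ccontinuous f -> ccontinuous g ->
  T (a *: f + g) = a *: T f + T g.
Proof.
move=> cf cg.
have ca : ccontinuous (a *: f + g) by apply: ccontinuousD cg; exact: ccontinuousZ.
rewrite !hausdorffE//; apply/funext => z.
have mray : measurable ray by [].
have [fR fI] := (integrable_Re_curve inv_fin z cf, integrable_Im_curve inv_fin z cf).
have [gR gI] := (integrable_Re_curve inv_fin z cg, integrable_Im_curve inv_fin z cg).
have Z (h : R -> R) (b : R) : mu.-integrable ray (EFin \o h) ->
    mu.-integrable ray (EFin \o (fun t => b * h t)).
  by move=> ih; apply: eq_integrable (integrableZl _ b ih).
have D (h k : R -> R) : mu.-integrable ray (EFin \o h) -> mu.-integrable ray (EFin \o k) ->
    mu.-integrable ray (EFin \o (fun t => h t + k t)).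
  by move=> ih ik; apply: eq_integrable (integrableD _ ih ik).
have B (h k : R -> R) : mu.-integrable ray (EFin \o h) -> mu.-integrable ray (EFin \o k) ->
    mu.-integrable ray (EFin \o (fun t => h t - k t)).
  by move=> ih ik; apply: eq_integrable (integrableB _ ih ik).
pose u t := t^-1 * Re (f (Re z * t^-1 +i* (Im z * t^-1))).
pose v t := t^-1 * Im (f (Re z * t^-1 +i* (Im z * t^-1))).
pose u' t := t^-1 * Re (g (Re z * t^-1 +i* (Im z * t^-1))).
pose v' t := t^-1 * Im (g (Re z * t^-1 +i* (Im z * t^-1))).
have eR : \int[mu]_(t in ray) (t^-1 * Re ((a *: f + g) (Re z * t^-1 +i* (Im z * t^-1)))) =
    \int[mu]_(t in ray) (Re a * u t - Im a * v t + u' t).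
  apply: eq_Rintegral => t _; rewrite /u /v /u'.
  rewrite -[(a *: _ + _) _]/(a * f _ + g _).
  by move: (f _) (g _) => [? ?] [? ?]; case: (a) => x y /=; ring.
have eI : \int[mu]_(t in ray) (t^-1 * Im ((a *: f + g) (Re z * t^-1 +i* (Im z * t^-1)))) =
    \int[mu]_(t in ray) (Re a * v t + Im a * u t + v' t).
  apply: eq_Rintegral => t _; rewrite /u /v /v'.
  rewrite -[(a *: _ + _) _]/(a * f _ + g _).
  by move: (f _) (g _) => [? ?] [? ?]; case: (a) => x y /=; ring.
rewrite /hausdorff_on eR eI.
rewrite RintegralD ?RintegralB ?RintegralZl//; [|exact: Z|exact: Z|by apply: B; exact: Z].
rewrite RintegralD ?RintegralD ?RintegralZl//; [|exact: Z|exact: Z|by apply: D; exact: Z].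
rewrite -[RHS]/(a * (_ +i* _) + (_ +i* _)) -/u -/v -/u' -/v'.
by case: (a) => x y; apply/eqP; rewrite eq_complex/= !eqxx.
Qed.

Lemma hausdorff_cst (b : C) : T (fun=> b) = (fun=> c%:C * b).
Proof.
rewrite hausdorffE//; last exact: ccontinuous_cst.
apply/funext => z; rewrite /hausdorff_on !RintegralZr//; try exact: integrable_inv.
by case: b => x y; apply/eqP; rewrite eq_complex/= !mul0r subr0 addr0 !eqxx.
Qed.

Lemma cesaro_mean_cst (b : C) n :
  cesaro_mean T n (fun=> b : C^o) = (fun=> (cesaro_power c n)%:C * b).
Proof.
have it k : iter k T (fun=> b) = (fun=> (c ^+ k)%:C * b).
  elim: k => [|k IH]; first by apply/funext => z /=; rewrite expr0 mul1r.
  by rewrite iterS IH hausdorff_cst; apply/funext => z; rewrite mulrA -rmorphM -exprS.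
have S : \sum_(1 <= k < n.+1) iter k T (fun=> b : C^o) =
    (fun=> (\sum_(1 <= k < n.+1) c ^+ k)%:C * b).
  elim: n => [|n IH]; first by apply/funext => z; rewrite !big_geq// mul0r.
  rewrite big_nat_recr// IH it [in RHS]big_nat_recr//; apply/funext => z.
  by rewrite rmorphD mulrDl.
rewrite /cesaro_mean S; apply/funext => z.
rewrite -[LHS]/(n%:R^-1 * (_ * b)) /cesaro_power rmorphM/= mulrA; congr (_ * _ * _).
by rewrite fmorphV rmorph_nat.
Qed.

Lemma entire_hausdorff f : entire f -> entire (T f).
Proof.
by move=> fe; rewrite (hausdorffE inv_fin (entire_continuous fe)); exact: entire_hausdorff_on.
Qed.

Section means.
Variables (p q : \bar R) (phi : R -> R).
Hypothesis p1 : (1 <= p)%E.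
Hypothesis q1 : (1 <= q)%E.
Hypothesis phiw : is_weight q phi.

Let c0 : 0 <= c. Proof. exact: inv_mass_ge0. Qed.

Lemma integral_mean_hausdorff f (r : R) : entire f -> 0 <= r ->
  (integral_mean p (T f) r <= c%:E * integral_mean p f r)%E.
Proof.
move=> fe r0; rewrite (hausdorffE inv_fin (entire_continuous fe)).
exact: integral_mean_hausdorff_on.
Qed.

Lemma iter_hausdorff f k : entire f -> entire (iter k T f) /\
  forall r : R, 0 <= r -> (integral_mean p (iter k T f) r <= (c ^+ k)%:E * integral_mean p f r)%E.
Proof.
move=> fe; elim: k => [|k [ke km]]; first by split=> // r _; rewrite expr0 mul1e.
split; first exact: entire_hausdorff.
move=> r r0; rewrite iterS; apply: le_trans (integral_mean_hausdorff ke r0) _.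
by rewrite exprS EFinM -muleA lee_wpmul2l ?lee_fin//; exact: km.
Qed.

Lemma cesaro_mean_hausdorff (f : C^o -> C^o) n : entire f -> entire (cesaro_mean T n f) /\
  forall r : R, 0 <= r ->
    (integral_mean p (cesaro_mean T n f) r <= (cesaro_power c n)%:E * integral_mean p f r)%E.
Proof.
move=> fe; rewrite /cesaro_mean /cesaro_power.
pose S m := \sum_(1 <= k < m.+1) iter k T f.
have [Se Sm] : entire (S n) /\ forall r : R, 0 <= r ->
    (integral_mean p (S n) r <= (\sum_(1 <= k < n.+1) c ^+ k)%:E * integral_mean p f r)%E.
  elim: n => [|n [Se Sm]].
    have -> : S 0%N = fun=> 0 by rewrite /S big_geq.
    rewrite big_geq; last by [].
    split; first exact: entire_cst.
    by move=> r r0; rewrite mul0e integral_mean_cst// ComplexField.Normc.normc0.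
  have -> : S n.+1 = fun z => S n z + iter n.+1 T f z.
    by rewrite /S big_nat_recr.
  rewrite big_nat_recr; last by [].
  have [ke km] := iter_hausdorff n.+1 fe.
  split; first exact: (entireD Se ke).
  move=> r r0; apply: le_trans (integral_meanD r p1 (entire_continuous Se) (entire_continuous ke)) _.
  rewrite EFinD ge0_muleDl ?lee_fin ?exprn_ge0//; last first.
    by rewrite sumr_ge0// => k _; exact: exprn_ge0.
  by apply: leeD; [exact: Sm|exact: km].
rewrite -/(S n).
have -> : n%:R^-1 *: S n = fun z => (n%:R^-1)%:C * S n (1 * z).
  by apply/funext => z; rewrite mul1r fmorphV rmorph_nat.
split; first exact: entire_scale.
move=> r r0; rewrite (@integral_meanZ _ p r p1 r0 _ (fun z => S n (1 * z))); last first.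
  by under eq_fun do rewrite mul1r; exact: entire_continuous.
under eq_fun do rewrite mul1r.
rewrite normc_real ger0_norm// EFinM -muleA lee_wpmul2l ?lee_fin//.
exact: Sm.
Qed.

End means.
End finite_mass.
End half_line.

(** * Mean ergodicity *)

Section ergodicity.
Context (R : realType).
Local Notation C := R[i].
Local Notation normc := (@ComplexField.Normc.normc R).
Variable mu : {measure set (measurableTypeR R) -> \bar R}.
Hypothesis mu_lt1 : mu `]0, 1[%classic = 0%E.
Variables (p q : \bar R) (phi : R -> R).
Hypothesis p1 : (1 <= p)%E.
Hypothesis q1 : (1 <= q)%E.
Hypothesis phiw : is_weight q phi.
Local Notation ray := (`[1%R, +oo[%classic : set (measurableTypeR R)).
Local Notation T := (hausdorff mu).
Local Notation c := (inv_mass mu ray).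
Local Notation F := (fock p q phi).
Local Notation N := (fock_norm p q phi).

Lemma fock_norm0 : N (fun=> 0) = 0%E.
Proof.
apply/eqP; rewrite eq_le fock_norm_ge0// andbT.
rewrite -(mul0e (N (fun=> 0))); apply: fock_norm_dominated => //.
- exact: ccontinuous_cst.
- exact: ccontinuous_cst.
- by move=> r r0; rewrite mul0e integral_mean_cst// ComplexField.Normc.normc0.
Qed.

Lemma fock_dominated f g (a : R) : entire g -> F f -> 0 <= a ->
  (forall r, 0 <= r -> (integral_mean p g r <= a%:E * integral_mean p f r)%E) ->
  F g /\ (N g <= a%:E * N f)%E.
Proof.
move=> ge [fe Nf] a0 gf.
have H : (N g <= a%:E * N f)%E.
  by apply: fock_norm_dominated => //; exact: entire_continuous.
by split=> //; split=> //; apply: le_lt_trans H _; rewrite lte_mul_pinfty ?lee_fin.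
Qed.

Lemma opnorm_le (S : (C^o -> C^o) -> C^o -> C^o) (a : R) : 0 <= a ->
  (forall f, F f -> (N (S f) <= a%:E * N f)%E) ->
  (0 <= opnorm F N S <= a%:E)%E.
Proof.
move=> a0 Sa; apply/andP; split.
  apply: (@le_trans _ _ (N (S (fun=> 0)))); first exact: fock_norm_ge0.
  apply: ereal_sup_ubound; exists (fun=> 0) => //.
  by split; [exact: fock_cst|rewrite fock_norm0 lee01].
apply: ge_ereal_sup => _ [f [Ff f1] <-]; apply: le_trans (Sa f Ff) _.
by rewrite -[leRHS]mule1 lee_wpmul2l ?lee_fin.
Qed.

Section finite_mass.
Hypothesis inv_fin : (\int[mu]_(t in ray) (t^-1)%:E < +oo)%E.

Let c0 : 0 <= c. Proof. exact: inv_mass_ge0. Qed.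

Lemma hausdorff_bounded : bounded_operator F N T.
Proof.
have TF f : F f -> F (T f) /\ (N (T f) <= c%:E * N f)%E.
  move=> Ff; have fe := Ff.1.
  apply: fock_dominated Ff c0 _; first exact: entire_hausdorff.
  by move=> r r0; exact: integral_mean_hausdorff.
split=> [f /TF[]//|a f g [fe _] [ge _]|].
  by apply: hausdorff_linear => //; exact: entire_continuous.
by exists c => f /TF[].
Qed.

Lemma hausdorff_is_defined : hausdorff_defined mu p q phi.
Proof. by move=> f [fe _] z; apply: cintegrable_hausdorff => //; exact: entire_continuous. Qed.

Lemma cvg_opnorm_cesaro_mean : c < 1 ->
  (fun n => opnorm F N (cesaro_mean T n)) @ \oo --> 0%E.
Proof.
move=> c1.
apply: (@squeeze_cvge _ _ _ _ (cst 0%E) _ (EFin \o cesaro_power c)).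
- apply: nearW => n; apply: opnorm_le => [|f Ff]; first exact: cesaro_power_ge0.
  have [me mm] := cesaro_mean_hausdorff mu_lt1 inv_fin p1 n Ff.1.
  by have [] := fock_dominated me Ff (cesaro_power_ge0 n c0) mm.
- exact: cvg_cst.
- by apply: cvg_EFin; [exact: nearW|apply: cvg_cesaro_power; rewrite c0].
Qed.

Lemma hausdorff_mean_ergodic : c < 1 -> uniformly_mean_ergodic F N T.
Proof.
move=> c1; split; first exact: hausdorff_bounded.
exists (fun _ _ => 0); split.
  split=> [f _|a f g _ _|]; first exact: fock_cst.
    by apply/funext => z; rewrite -[RHS]/(a * 0 + 0) mulr0 addr0.
  by exists 0 => f _; rewrite mul0e fock_norm0.
have -> : (fun n => opnorm F N (fun f => cesaro_mean T n f - (fun=> 0))) =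
    (fun n => opnorm F N (cesaro_mean T n)).
  apply/funext => n; congr opnorm; apply/funext => f; exact: subr0.
exact: cvg_opnorm_cesaro_mean.
Qed.

(** The test function is the constant [e], where [e] makes its norm at most 1. *)
Lemma mean_ergodic_inv_mass : uniformly_mean_ergodic F N T -> c <= 1.
Proof.
move=> [_ [P [[PF _ _]]]] /fine_cvgP[fin cv]; rewrite leNgt; apply/negP => c1.
have [_ N1] := fock_cst p1 q1 phiw 1.
have [M M0 NM] : exists2 M : R, 0 <= M & N (fun=> 1) = M%:E.
  exists (fine (N (fun=> 1))); first by rewrite fine_ge0// fock_norm_ge0.
  by rewrite fineK// ge0_fin_numE// fock_norm_ge0.
(* M may vanish, hence the shift by 1 *)
pose e := (1 + M)^-1; have e0 : 0 < e by rewrite invr_gt0; lra.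
pose u : C^o -> C^o := fun=> e%:C.
have Fu : F u := fock_cst p1 q1 phiw _.
have Nu : (N u <= 1)%E.
  have := @fock_norm_dominated _ p q phi p1 q1 phiw u (fun=> 1) e (ccontinuous_cst _) (ccontinuous_cst _) (ltW e0).
  rewrite NM => /(_ _)/le_trans; apply.
    move=> r r0; rewrite !integral_mean_cst// normc_real ger0_norm ?(ltW e0)//.
    by rewrite (normc_real 1) normr1 mule1.
  by rewrite -EFinM lee_fin /e mulrC ler_pdivrMr; lra.
pose D n := cesaro_mean T n u - P u.
have [n0 Hn0] : exists n0, forall n, (n0 <= n)%N -> (N (D n) <= 1)%E.
  have : \forall n \near \oo, (opnorm F N (fun f => (cesaro_mean T n f - P f)%R) <= 1%:E)%E.
    move/cvgrPdist_le/(_ _ ltr01): cv => cv; apply: filterS2 fin cv => n fn /=.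
    by rewrite sub0r normrN -{2}(fineK fn) lee_fin => /(le_trans (ler_norm _)).
  move=> [n0 _ Hn0]; exists n0 => n /Hn0; apply: le_trans.
  by apply: ereal_sup_ubound; exists u.
have [Pe _] := PF u Fu; have cP := entire_continuous Pe.
have [K HK] := ccontinuous_bounded 1 cP.
have K0 : 0 <= K by apply: le_trans (normc_ge0 _) (HK 0 _); rewrite ComplexField.Normc.normc0.
have [w w0 Hw] := fock_norm_lower p1 q1 phiw.
have [n /Hn0 Nn an] := cesaro_power_unbounded ((K + 2 / w) / e) n0 c1.
set a := cesaro_power c n in an.
have a_big : K + 2 / w < a * e by rewrite -ltr_pdivrMr.
have w2 : 0 < 2 / w by rewrite divr_gt0.
have ae0 : 0 <= a * e by lra.
have ce : ccontinuous (D n).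
  by rewrite /D cesaro_mean_cst//; apply: ccontinuousB => //; exact: ccontinuous_cst.
have : (((a * e - K) * w)%:E <= N (D n))%E.
  apply: Hw => // [|r /andP[r0 r1]]; first by lra.
  rewrite EFinB leeBlDr//.
  have mP : (integral_mean p (P u) r <= K%:E)%E.
    by apply: integral_mean_bound => // z zr; apply: HK; rewrite zr.
  have -> : (a * e)%:E = integral_mean p (fun z => D n z + P u z)%R r.
    rewrite (_ : (fun z => _) = fun=> (a * e)%:C) ?integral_mean_cst// ?normc_real ?ger0_norm//.
    apply/funext => z; rewrite /D cesaro_mean_cst// -[LHS]/(_ - _ + _) subrK.
    exact: esym (rmorphM _ _ _).
  by apply: le_trans (integral_meanD r p1 ce cP) _; apply: leeD.
move=> /le_trans/(_ Nn); rewrite lee_fin leNgt => /negP; apply.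
have -> : 1 = w^-1 * w by rewrite mulVf// gt_eqF.
rewrite ltr_pM2r//; have : 0 < w^-1 by rewrite invr_gt0.
by move: a_big; lra.
Qed.

End finite_mass.
End ergodicity.

Theorem theorem11 (R : realType)
    (mu : {measure set (measurableTypeR R) -> \bar R})
    (* mu is a Borel measure on the open half-line, seen as a measure on R *)
    (mu_half_line : mu `]-oo, 0]%classic = 0%E)
    (mu_lt1 : mu `]0, 1[%classic = 0%E)
    (p q : \bar R) (p_ge1 : (1 <= p)%E) (q_ge1 : (1 <= q)%E)
    (phi : R -> R) (phi_weight : is_weight q phi) :
  (hausdorff_uniformly_mean_ergodic mu p q phi ->
     (\int[mu]_(t in `[1%R, +oo[) (t^-1)%:E <= 1)%E) /\
  ((\int[mu]_(t in `[1%R, +oo[) (t^-1)%:E < 1)%E ->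
     hausdorff_uniformly_mean_ergodic mu p q phi /\
     (fun n => opnorm (fock p q phi) (fock_norm p q phi)
                 (cesaro_mean (hausdorff mu) n)) @ \oo --> 0%E).
Proof.
split=> [[defined ergodic]|mass_lt1].
  have inv_fin := inv_integral_fin mu_lt1 (defined _ (fock_cst p_ge1 q_ge1 phi_weight 1) 0).
  rewrite inv_massE// lee_fin.
  exact: mean_ergodic_inv_mass ergodic.
have inv_fin : (\int[mu]_(t in `[1%R, +oo[) (t^-1)%:E < +oo)%E := lt_trans mass_lt1 (ltry 1).
have c1 : inv_mass mu `[1, +oo[ < 1 by rewrite -lte_fin -inv_massE.
split; last exact: cvg_opnorm_cesaro_mean.
split; first exact: hausdorff_is_defined.
exact: hausdorff_mean_ergodic.
Qed.
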